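(* Suppose the constrained Markov decision process described in the context satisfies conditions (G), (SU) and (M) stated there. Then the following hold for the linear programs (P) and (P$^*$) defined in the context: (i) (P) is consistent (it has a feasible solution) and solvable (it has an optimal solution), and (P$^*$) is consistent. (ii) There is no duality gap: $\inf(\mathrm{P})=\sup(\mathrm{P}^* )=\rho_c^*$.
   Context: MDP model. $\mathbb{X}$ (state space) is a Borel space, i.e., a separable metrizable space homeomorphic to a Borel subset of a Polish space. $\mathbb{A}$ (action space) is a countable set with the discrete topology. For a topological space $X$, $\mathcal{B}(X)$ is its Borel $\sigma$-algebra and $\mathcal{P}(X)$ the set of Borel probability measures; for $X$ a Borel space, $\mathcal{P}(X)$ carries the topology of weak convergence. Each $x\in\mathbb{X}$ has a nonempty set $A(x)\subset\mathbb{A}$ of admissible actions, and $\Gamma=\{(x,a): x\in\mathbb{X}, a\in A(x)\}$ is a Borel subset of $\mathbb{X}\times\mathbb{A}$. The state transition kernel $q(dy\,|\,x,a)$ is a Borel measurable stochastic kernel on $\mathbb{X}$ given $\mathbb{X}\times\mathbb{A}$ (i.e., a Borel measurable map into $\mathcal{P}(\mathbb{X})$). The one-stage cost functions $c_0,c_1,\ldots,c_d:\mathbb{X}\times\mathbb{A}\to[0,+\infty]$ are Borel measurable, finite on $\Gamma$ and equal to $+\infty$ outside $\Gamma$; their restrictions to $\Gamma$ are denoted by the same symbols. $\kappa=(\kappa_1,\ldots,\kappa_d)\ge0$ is a given vector of upper limits in $\mathbb{R}^d$. Policies and average costs. A policy is a sequence $\pi=(\mu_0,\mu_1,\ldots)$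 where $\mu_n(da_n\,|\,x_0,a_0,\ldots,a_{n-1},x_n)$ is a Borel measurable stochastic kernel on $\mathbb{A}$ given $(\mathbb{X}\times\mathbb{A})^n\times\mathbb{X}$ with $\mu_n(A(x_n)\,|\,x_0,a_0,\ldots,a_{n-1},x_n)=1$ everywhere; $\Pi$ is the set of all policies. A policy $\pi$ and an initial distribution $\zeta\in\mathcal{P}(\mathbb{X})$, together with $q$, determine the law of the process $\{(x_n,a_n)\}_{n\ge0}$, with expectation $\mathbf{E}^\pi_\zeta$. For $0\le i\le d$, $J_i(\pi,\zeta)=\limsup_{n\to\infty} n^{-1}\mathbf{E}^\pi_\zeta\big[\sum_{k=0}^{n-1}c_i(x_k,a_k)\big]$. The feasible set is $\mathcal{S}=\{(\pi,\zeta)\in\Pi\times\mathcal{P}(\mathbb{X}): J_0(\pi,\zeta)<\infty,\ J_i(\pi,\zeta)\le\kappa_i,\ i=1,\ldots,d\}$, and $\rho_c^*=\inf_{(\pi,\zeta)\in\mathcal{S}}J_0(\pi,\zeta)$. Conditions. (G) $\mathcal{S}\ne\varnothing$. (SU) There is a nondecreasing sequence of compact sets $\Gamma_j\uparrow\Gamma$ such that for some $0\le i\le d$, $\lim_{j\to\infty}\inf_{(x,a)\in\Gamma_j^c}c_i(x,a)=+\infty$ (complement in $\mathbb{X}\times\mathbb{A}$). (M) With $\Gamma_j$ as in (SU), for each compact set $K\in\{\mathrm{proj}_{\mathbb{X}}(\Gamma_j)\}$ (projections of the $\Gamma_j$ on $\mathbb{X}$) there exist an open set $O\supset K$, a closed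 set $D\subset\mathbb{X}$ (possibly empty) and a finite measure $\nu$ on $\mathcal{B}(\mathbb{X})$, all possibly depending on $K$, such that $q\big((O\setminus D)\cap B\,|\,x,a\big)\le\nu(B)$ for all $B\in\mathcal{B}(\mathbb{X})$ and $(x,a)\in\Gamma$, and such that, restricted to $D\times\mathbb{A}$, the kernel $q(dy\,|\,x,a)$ is continuous (as a map into $\mathcal{P}(\mathbb{X})$) and all the functions $c_i$, $0\le i\le d$, are lower semicontinuous. Linear programs. Let $w(x,a)=1+\sup_{0\le i\le d}c_i(x,a)$ on $\Gamma$. $\mathbb{M}^+_w(\Gamma)$ is the set of finite nonnegative Borel measures $\gamma$ on $\Gamma$ with $\int w\,d\gamma<\infty$. $\mathbb{F}_b(\mathbb{X})$ is the set of bounded real-valued Borel measurable functions on $\mathbb{X}$. $\hat\gamma$ is the marginal of $\gamma$ on $\mathbb{X}$, and $\langle\gamma,c_i\rangle=\int_\Gamma c_i\,d\gamma$. Vector inequalities are componentwise. (P): minimize $\langle\gamma,c_0\rangle$ over $\gamma\in\mathbb{M}_w^+(\Gamma)$ and $\alpha\in\mathbb{R}^d$, $\alpha\ge0$, subject to $\gamma(\Gamma)=1$; $\hat\gamma(B)=\int_\Gamma q(B\,|\,x,a)\,\gamma(d(x,a))$ for all $B\in\mathcal{B}(\mathbb{X})$; and $\big(\langle\gamma,c_1\rangle,\ldots,\langle\gamma,c_d\rangle\big)+\alpha=\kappa$. (P$^*$): maximize $\rho+\sum_{i=1}^d\beta_i\kappa_i$ over $(\rho,h,\beta)\in\mathbb{R}\times\mathbb{F}_b(\mathbb{X})\times\mathbb{R}^d$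 subject to $\rho+h(x)-\int_{\mathbb{X}}h(y)\,q(dy\,|\,x,a)+\sum_{i=1}^d\beta_ic_i(x,a)\le c_0(x,a)$ for all $(x,a)\in\Gamma$, and $\beta\le0$. $\inf(\mathrm{P})$ and $\sup(\mathrm{P}^* )$ denote the optimal values of these programs. *)

(* Defs.v *)
From HB Require Import structures.
From mathcomp Require Import all_boot all_order all_algebra.
From mathcomp Require Import all_classical all_reals all_analysis.
From mathcomp Require Import measurable_realfun.

Set Implicit Arguments.
Unset Strict Implicit.
Unset Printing Implicit Defensive.

Import Order.TTheory GRing.Theory Num.Theory.
Import numFieldNormedType.Exports.

Local Open Scope classical_set_scope.
Local Open Scope ring_scope.

HB.mixin Record Measurable_isBorel d T & Measurable d T & Topological T := {
  measurable_borelE : @measurable d T = <<s open >> }.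

#[short(type="borelType")]
HB.structure Definition Borel d :=
  { T of Measurable d T & Topological T & Measurable_isBorel d T }.

Definition separable_space (T : topologicalType) : Prop :=
  exists2 D : set T, countable D & dense D.

(* Stated without the library's [Complete] structure, which would force the
   space to be pointed. *)
Definition complete_space (R : realType) (T : metricType R) : Prop :=
  forall F : set_system T, ProperFilter F -> cauchy F -> exists x : T, F --> x.

(* Separability and metrizability of [X] follow from the homeomorphism with
   a subset of the separable metric space [Y]. *)
Definition borel_space (R : realType) (X : topologicalType) : Prop :=
  exists (Y : metricType R) (B : set Y) (f : X -> Y) (g : Y -> X),
    [/\ separable_space Y /\ complete_space Y,
        <<s open >> B,
        set_bij setT B f /\ cancel f g,
        continuous f &
        {within B, continuous g}].

Definition discrete_space (T : topologicalType) : Prop :=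
  forall S : set T, open S.

(* Topology of weak convergence on P(X): the coarsest topology that makes
   mu |-> \int f dmu continuous for every bounded continuous f. *)
Section weak_convergence.
Context (R : realType) d (X : borelType d).

Definition bounded_continuous : Type :=
  {f : X -> R | continuous f /\ exists M : R, forall x, `|f x| <= M}.

Definition integral_evaluation (mu : probability X R) :
    {ptws bounded_continuous -> R} :=
  fun f => Rintegral mu setT (sval f).

Definition weak_probability : topologicalType :=
  initial_topology integral_evaluation.

End weak_convergence.

(* A probability kernel as a map into P(X). *)
Section kernel_probability.
Context (R : realType) d d' (T : measurableType d) (X : borelType d').
Variables (q : R.-pker T ~> X) (t : T).

Definition kernel_at (B : set X) : \bar R := q t B.

Let kernel_at0 : kernel_at set0 = 0%E. Proof. exact: measure0. Qed.

Let kernel_at_ge0 B : (0 <= kernel_at B)%E. Proof. exact: measure_ge0. Qed.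

Let kernel_at_sigma_additive : semi_sigma_additive kernel_at.
Proof. exact: measure_semi_sigma_additive. Qed.

HB.instance Definition _ := isMeasure.Build _ _ _ kernel_at
  kernel_at0 kernel_at_ge0 kernel_at_sigma_additive.

HB.instance Definition _ := Measure_isProbability.Build _ _ _ kernel_at
  (prob_kernel t).

Definition kernel_probability : weak_probability R X :=
  (kernel_at : probability X R).

End kernel_probability.

Section mdp.
Context (R : realType) dX dA (X : borelType dX) (A : borelType dA) (d : nat).
Local Open Scope ereal_scope.

(* [mdp_cost ord0] is c_0 and, for [i : 'I_d], [mdp_cost (lift ord0 i)] is the
   (i+1)-st constraint cost, with limit [mdp_kappa i]. On [X * A], which is
   second countable as soon as [X] and [A] are, the product sigma-algebra used
   by the library is the Borel sigma-algebra. *)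
Record mdp := MDP {
  mdp_adm : X -> set A;
  mdp_adm_nonempty : forall x, mdp_adm x !=set0;
  mdp_graph := [set z : X * A | mdp_adm z.1 z.2];
  mdp_graph_measurable : measurable mdp_graph;
  mdp_trans : R.-pker (X * A) ~> X;
  mdp_cost : 'I_d.+1 -> X * A -> \bar R;
  mdp_cost_measurable : forall i, measurable_fun [set: X * A] (mdp_cost i);
  mdp_cost_ge0 : forall i z, 0 <= mdp_cost i z;
  mdp_cost_fin : forall i z, mdp_graph z -> mdp_cost i z < +oo;
  mdp_cost_out : forall i z, ~ mdp_graph z -> mdp_cost i z = +oo;
  mdp_kappa : 'I_d -> R;
  mdp_kappa_ge0 : forall i, (0 <= mdp_kappa i)%R }.

(* ([:: (x_0, a_0); ...; (x_(n-1), a_(n-1))], x_n) *)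
Local Notation history n := (n.-tuple (X * A) * X)%type.

Definition history_next n (h : history n) (ay : A * X) : history n.+1 :=
  ([tuple of rcons h.1 (h.2, ay.1)], ay.2).

Lemma measurable_history_next n :
  measurable_fun [set: history n * (A * X)]
    (fun p => history_next p.1 p.2).
Proof.
have mt : measurable_fun [set: history n * (A * X)] (fun p => p.1.1).
  exact: (measurableT_comp measurable_fst measurable_fst).
have mx : measurable_fun [set: history n * (A * X)] (fun p => p.1.2).
  exact: (measurableT_comp measurable_snd measurable_fst).
have ma : measurable_fun [set: history n * (A * X)] (fun p => p.2.1).
  exact: (measurableT_comp measurable_fst measurable_snd).
have my : measurable_fun [set: history n * (A * X)] (fun p => p.2.2).
  exact: (measurableT_comp measurable_snd measurable_snd).
apply/measurable_fun_pair => //=.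
apply/measurable_fun_tnthP => i /=.
have [lt_in|le_ni] := ltnP i n.
  rewrite (_ : _ \o _ = (fun t => tnth t (Ordinal lt_in)) \o (fun p => p.1.1)).
    exact: measurableT_comp (measurable_tnth _) mt.
  apply/funext => -[[t x] [a y]] /=.
  by rewrite (tnth_nth (x, a)) [RHS](tnth_nth (x, a))/= nth_rcons size_tuple lt_in.
rewrite (_ : _ \o _ = (fun p => (p.1.2, p.2.1))).
  exact/measurable_fun_pair.
apply/funext => -[[t x] [a y]] /=.
rewrite (tnth_nth (x, a))/= nth_rcons size_tuple ltnNge le_ni/=.
by rewrite eqn_leq le_ni -ltnS ltn_ord.
Qed.

Section trajectory_law.
Variables (mu : forall n, R.-pker (history n) ~> A) (q : R.-pker (X * A) ~> X).
Variable zeta : probability X R.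

Definition history_trans n (ha : history n * A) : {measure set X -> \bar R} :=
  q (ha.1.2, ha.2).

Let measurable_history_trans n (S : set X) : measurable S ->
  measurable_fun [set: history n * A] ((@history_trans n) ^~ S).
Proof.
move=> mS; apply: (measurableT_comp (measurable_kernel q S mS)).
apply/measurable_fun_pair => //=.
exact: (measurableT_comp measurable_snd measurable_fst).
Qed.

HB.instance Definition _ n := isKernel.Build _ _ _ _ _ (@history_trans n)
  (@measurable_history_trans n).

Let history_trans_setT n ha : @history_trans n ha setT = 1.
Proof. exact: prob_kernel. Qed.

HB.instance Definition _ n := Kernel_isProbability.Build _ _ _ _ _
  (@history_trans n) (@history_trans_setT n).

(* Probability of [S] for the history up to x_(n+1), given the history [h] up
   to x_n. *)
Definition history_step n (S : set (history n.+1)) (h : history n) : \bar R :=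
  \int[mu n h]_a q (h.2, a) [set y | S (history_next h (a, y))].

Let measurable_next n (S : set (history n.+1)) : measurable S ->
  measurable [set p : history n * A * X | S (history_next p.1.1 (p.1.2, p.2))].
Proof.
move=> mS; rewrite -[X in measurable X]setTI.
have H : measurable_fun [set: history n * A * X]
    (fun p => (p.1.1, (p.1.2, p.2))).
  apply/measurable_fun_pair => /=.
    exact: (measurableT_comp measurable_fst measurable_fst).
  apply/measurable_fun_pair => //=.
  exact: (measurableT_comp measurable_snd measurable_fst).
exact: (measurableT_comp (@measurable_history_next n) H).
Qed.

Let measurable_next_section n (S : set (history n.+1)) h a : measurable S ->
  measurable [set y | S (history_next (h : history n) (a, y))].
Proof.
move=> /measurable_next mS.
have := measurable_xsection (h, a) mS.
by rewrite xsectionE.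
Qed.

Let measurable_step_inner n (S : set (history n.+1)) : measurable S ->
  measurable_fun [set: history n * A]
    (fun ha => q (ha.1.2, ha.2) [set y | S (history_next ha.1 (ha.2, y))]).
Proof.
move=> mS; have mN := measurable_next mS.
have := @measurable_kfcomp _ _ _ _ R (@history_trans n) (EFin \o \1__)
  (proj2 (measurable_EFinP _ _) (measurable_indic mN)).
rewrite kfcompkindic//.
under [in X in measurable_fun _ X]eq_fun do rewrite xsectionE.
by apply => // t; rewrite lee_fin.
Qed.

Let measurable_step n (S : set (history n.+1)) : measurable S ->
  measurable_fun [set: history n] (history_step S).
Proof.
move=> mS; apply: (measurable_kfcomp (mu n) (measurable_step_inner mS)).
by move=> t; exact: measure_ge0.
Qed.

Section next_law.
Variables (n : nat) (P : probability (history n) R).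

Definition next_law (S : set (history n.+1)) : \bar R :=
  \int[P]_h history_step S h.

Let next_law0 : next_law set0 = 0.
Proof.
rewrite /next_law; apply: integral0_eq => h _.
by apply: integral0_eq => a _; rewrite measure0.
Qed.

Let step_ge0 (S : set (history n.+1)) h : 0 <= history_step S h.
Proof. by apply: integral_ge0 => a _. Qed.

Let next_law_ge0 S : 0 <= next_law S.
Proof. by apply: integral_ge0 => h _. Qed.

Let next_law_sigma_additive : semi_sigma_additive next_law.
Proof.
move=> S mS tS mUS.
have mq i h : measurable_fun [set: A]
    (fun a => q (h.2, a) [set y | S i (history_next (h : history n) (a, y))]).
  have := measurable_step_inner (mS i).
  by move=> /(measurableT_comp)/(_ (pair1_measurable h)).
rewrite [X in _ --> X](_ : _ = \sum_(i <oo) next_law (S i)).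
  by apply: is_cvg_nneseries => i _ _; exact: next_law_ge0.
rewrite /next_law -integral_nneseries//; last by move=> i; exact: measurable_step.
apply: eq_integral => h _; rewrite /history_step -integral_nneseries//.
apply: eq_integral => a _.
rewrite (_ : [set y | _] =
  \bigcup_i [set y | S i (history_next h (a, y))])//.
apply/esym/cvg_lim => //; apply: measure_semi_sigma_additive.
- by move=> i; exact: measurable_next_section.
- apply/trivIsetP => i j _ _ ij; apply/seteqP; split=> // y [/= Si Sj].
  by move/trivIsetP : tS => /(_ i j I I ij); rewrite -subset0 => /(_ _ (conj Si Sj)).
- by apply: bigcup_measurable => i _; exact: measurable_next_section.
Qed.

HB.instance Definition _ := isMeasure.Build _ _ _ next_law
  next_law0 next_law_ge0 next_law_sigma_additive.

Let next_law_setT : next_law setT = 1.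
Proof.
rewrite /next_law (eq_integral (cst 1)); last first.
  move=> h _; rewrite /history_step (eq_integral (cst 1)); last first.
    by move=> a _; exact: prob_kernel.
  by rewrite integral_cst// mul1e prob_kernel.
by rewrite integral_cst// mul1e; exact: probability_setT.
Qed.

HB.instance Definition _ := Measure_isProbability.Build _ _ _ next_law
  next_law_setT.

End next_law.

Definition init_history (x : X) : history 0 := ([tuple], x).

Definition init_law (S : set (history 0)) : \bar R :=
  zeta (init_history @^-1` S).

Let measurable_init : measurable_fun [set: X] init_history.
Proof. exact/measurable_fun_pair. Qed.

Let init_law0 : init_law set0 = 0.
Proof. by rewrite /init_law preimage_set0 measure0. Qed.

Let init_law_ge0 S : 0 <= init_law S. Proof. exact: measure_ge0. Qed.

Let init_law_sigma_additive : semi_sigma_additive init_law.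
Proof.
move=> S mS tS mUS; rewrite /init_law preimage_bigcup.
apply: measure_semi_sigma_additive.
- by move=> i; rewrite -[X in measurable X]setTI; exact: measurable_init.
- apply/trivIsetP => i j _ _ ij; rewrite -preimage_setI.
  by move/trivIsetP : tS => /(_ i j I I ij) ->; rewrite preimage_set0.
- by rewrite -preimage_bigcup -[X in measurable X]setTI; exact: measurable_init.
Qed.

HB.instance Definition _ := isMeasure.Build _ _ _ init_law
  init_law0 init_law_ge0 init_law_sigma_additive.

Let init_law_setT : init_law setT = 1.
Proof. by rewrite /init_law preimage_setT probability_setT. Qed.

HB.instance Definition _ := Measure_isProbability.Build _ _ _ init_law
  init_law_setT.

(* The joint law of (x_0, a_0, ..., x_(n-1), a_(n-1), x_n). The law of the whole
   process is determined by these finite-dimensional laws, and the average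
   costs depend on nothing else. *)
Fixpoint history_law n : probability (history n) R :=
  if n is n'.+1 then next_law (history_law n') else init_law.

End trajectory_law.

Section model.
Variable M : mdp.

Record policy := Policy {
  policy_ker : forall n, R.-pker (history n) ~> A;
  policy_adm : forall n (h : history n), policy_ker n h (mdp_adm M h.2) = 1 }.

Definition expected_cost (pi : policy) (zeta : probability X R) (i : 'I_d.+1)
    (n : nat) : \bar R :=
  \int[history_law (policy_ker pi) (mdp_trans M) zeta n]_h
    \sum_(k < n) mdp_cost M i (tnth h.1 k).

Definition average_cost (pi : policy) (zeta : probability X R) (i : 'I_d.+1) :
    \bar R :=
  limn_esup (fun n => (n%:R^-1)%:E * expected_cost pi zeta i n).

Definition feasible_pairs : set (policy * probability X R) :=
  [set p | average_cost p.1 p.2 ord0 < +oo /\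
    forall i : 'I_d, average_cost p.1 p.2 (lift ord0 i) <= (mdp_kappa M i)%:E].

Definition optimal_cost : \bar R :=
  ereal_inf [set average_cost p.1 p.2 ord0 | p in feasible_pairs].

Definition cond_G : Prop := feasible_pairs !=set0.

(* [ereal_inf set0 = +oo] covers the case where [Gam j] is all of [X * A]. *)
Definition cond_SU (Gam : nat -> set (X * A)) : Prop :=
  [/\ {homo Gam : j k / (j <= k)%N >-> j `<=` k},
      forall j, compact (Gam j),
      \bigcup_j Gam j = mdp_graph M &
      exists i : 'I_d.+1,
        ereal_inf (mdp_cost M i @` ~` Gam j) @[j --> \oo] --> +oo].

(* Lower semicontinuity on the library's [subspace] only constrains the
   restriction: points outside of the subspace are isolated in it. *)
Definition cond_M (Gam : nat -> set (X * A)) : Prop :=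
  forall j, let K := fst @` Gam j in
  exists (O D : set X) (nu : {finite_measure set X -> \bar R}),
    [/\ open O /\ K `<=` O,
        closed D,
        forall B z, measurable B -> mdp_graph M z ->
          mdp_trans M z ((O `\` D) `&` B) <= nu B,
        {within D `*` setT, continuous (kernel_probability (mdp_trans M))} &
        forall i, lower_semicontinuous
          (mdp_cost M i : subspace (D `*` setT) -> \bar R)].

Definition weight (z : X * A) : \bar R :=
  1 + ereal_sup (range (fun i => mdp_cost M i z)).

(* A Borel measure on Gamma is encoded as a Borel measure on [X * A] that
   vanishes outside Gamma. *)
Definition weighted_measures : set {finite_measure set (X * A)%type -> \bar R} :=
  [set gamma | gamma (~` mdp_graph M) = 0 /\
    \int[gamma]_(z in mdp_graph M) weight z < +oo].

Definition pairing (gamma : {finite_measure set (X * A)%type -> \bar R})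
    (i : 'I_d.+1) : \bar R :=
  \int[gamma]_(z in mdp_graph M) mdp_cost M i z.

Definition primal_var : Type :=
  ({finite_measure set (X * A)%type -> \bar R} * ('I_d -> R))%type.

Definition primal_feasible : set primal_var :=
  [set v | let: (gamma, alpha) := v in
    [/\ weighted_measures gamma /\ (forall i : 'I_d, (0 <= alpha i)%R),
        gamma (mdp_graph M) = 1,
        forall B, measurable B ->
          gamma (B `*` setT) =
          \int[gamma]_(z in mdp_graph M) mdp_trans M z B &
        forall i : 'I_d, pairing gamma (lift ord0 i) + (alpha i)%:E =
          (mdp_kappa M i)%:E]].

Definition primal_objective (v : primal_var) : \bar R := pairing v.1 ord0.

Definition primal_value : \bar R :=
  ereal_inf (primal_objective @` primal_feasible).

Definition primal_consistent : Prop := primal_feasible !=set0.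

Definition primal_solvable : Prop :=
  exists2 v, primal_feasible v & primal_objective v = primal_value.

Definition bounded_measurable : set (X -> R) :=
  [set h : X -> R | measurable_fun [set: X] h /\ exists C : R, forall x, (`|h x| <= C)%R].

Definition dual_var : Type := (R * (X -> R) * ('I_d -> R))%type.

Definition dual_feasible : set dual_var :=
  [set v | let: (rho, h, beta) := v in
    [/\ bounded_measurable h,
        forall i, (beta i <= 0)%R &
        forall z, mdp_graph M z ->
          rho%:E + (h z.1)%:E - \int[mdp_trans M z]_y (h y)%:E
            + \sum_(i < d) (beta i)%:E * mdp_cost M (lift ord0 i) z
          <= mdp_cost M ord0 z]].

Definition dual_objective (v : dual_var) : \bar R :=
  let: (rho, _, beta) := v in
  (rho + \sum_(i < d) beta i * mdp_kappa M i)%R%:E.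

Definition dual_value : \bar R :=
  ereal_sup (dual_objective @` dual_feasible).

Definition dual_consistent : Prop := dual_feasible !=set0.

End model.
End mdp.

(* Main.v *)
Require Import Defs.
From HB Require Import structures.
From mathcomp Require Import all_boot all_order all_algebra.
From mathcomp Require Import all_classical all_reals all_analysis.
From mathcomp Require Import measurable_realfun ring lra.

Set Implicit Arguments.
Unset Strict Implicit.
Unset Printing Implicit Defensive.

Import Order.TTheory GRing.Theory Num.Theory.
Import numFieldNormedType.Exports.

Local Open Scope classical_set_scope.
Local Open Scope ring_scope.

(** The whole argument rests on one compactness principle,
    [ultralimit_occupation]. Take an ultrafilter of probabilities on
    state-action pairs which are carried by the graph of admissible pairs,
    nearly stationary, and of asymptotically bounded costs. Along it the
    measures of each set converge, but the setwise limit [m] is only finitely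
    additive. Bounded costs and (SU) make [m] tight: it nearly charges the
    compact sets of the increasing sequence. On a perfectly normal space a
    tight finitely additive probability has a countably additive
    regularization [mu], with [mu U <= m U] for [U] open
    ([finitely_additive_regularization]). The claim is that [mu] is stationary,
    carried by the graph, and that its costs do not exceed the limiting ones.

    Both claims reduce to [mu S <= m S] for the superlevel sets [S] of the
    costs and of the functions [q(U | .)], [U] open ([integral_le_layers]).
    Here the two halves of (M) divide the work. Over [O \ D] near stationarity
    transfers the majorization of the kernel by a finite measure to the
    marginals of [m]; since a compact set of pairs meets finitely many actions
    only, [m] is itself dominated there by finite measures up to small errors,
    hence coincides with [mu] ([regularization_dominated]). Over [D] the
    functions are lower semicontinuous, so that [S] agrees with an open set,
    for which [mu] is below [m]. Combining the two gives [mu S <= m S]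
    ([regularization_relatively_open]). Stationarity follows because the
    marginal of [mu] and its image by the kernel are both below the marginal
    of [m] on open sets, and such a countably additive minorant is unique
    ([regularization_unique]).

    The principle is used three times, through [primal_limit]:
    - for a minimizing sequence of (P): an optimal solution exists
      ([primal_consistent_solvable]);
    - for the averaged occupation measures of a feasible pair of a policy and
      an initial law: (P) has a feasible point whose objective is at most its
      average cost ([policy_primal]);
    - for approximate solutions of finitely many constraints of (P) with an
      objective bound [r]: when [r] exceeds the value of the dual, these exist
      by a separation argument in finite dimension ([finite_alternative]), and
      they cluster at a feasible point of (P) of objective at most [r]
      ([primal_value_le_of_dual]). With weak duality ([dual_le_primal]) this
      excludes a gap.

    Conversely, the actions being countable, a stationary occupation measure
    disintegrates by Radon-Nikodym densities into a stationary policy, under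
    which the state law is invariant and the average costs are the integrals
    of the costs ([occupation_policy]). Hence the value of (P) is also the
    optimal average cost ([primal_eq_optimal]). *)

(** * Limits of bounded functions along an ultrafilter *)

Section ultralimit.
Context (R : realType) (I : Type) (G : set_system I) {UG : UltraFilter G}.
Implicit Types f g : I -> R.

Definition ulim f : R := lim (f i @[i --> G]).

(** Ultrafilters on the compact segment [[-c, c]] converge. *)
Lemma ulim_cvg f (c : R) : (\forall i \near G, `|f i| <= c) -> f @ G --> ulim f.
Proof.
move=> fc; apply: cvg_toP => //; apply/cvg_ex.
have FA : (f @ G) [set` `[- c, c]].
  rewrite /= nbhs_filterE; apply: filterS fc => i /=.
  by rewrite in_itv /= -ler_norml.
have [p [_ clp]] := @segment_compact R (- c) c (f @ G) _ FA.
exists p => U Up; rewrite /= nbhs_filterE.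
have [//|nU] := in_ultra_setVsetC (f @^-1` U) UG.
by have [x [nUx Ux]] := clp (~` U) U nU Up.
Qed.

Lemma ulim_unique f l : f @ G --> l -> ulim f = l.
Proof. by move/cvg_lim; exact. Qed.

End ultralimit.

(** * Countably additive minorants on open sets of a finitely additive probability *)

(** Closed sets are zero sets. For metrizable spaces [g] is the distance to
    [C]; unlike a distance, this survives products with discrete spaces
    without any choice of a metric. *)
Definition perfectly_normal (R : realType) (T : topologicalType) : Prop :=
  forall C : set T, closed C -> exists g : T -> R,
    [/\ continuous g, forall x, 0 <= g x & C = [set x | g x = 0]].

Definition finitely_additive_probability (R : realType) d (T : measurableType d)
    (m : set T -> R) : Prop :=
  [/\ forall S, 0 <= m S, m setT = 1 &
      forall S1 S2, measurable S1 -> measurable S2 -> S1 `&` S2 = set0 ->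
        m (S1 `|` S2) = m S1 + m S2].

Lemma borel_open d (T : borelType d) (U : set T) : open U -> measurable U.
Proof. by rewrite measurable_borelE; exact: sub_sigma_algebra. Qed.

Lemma borel_closed d (T : borelType d) (U : set T) : closed U -> measurable U.
Proof.
by rewrite -openC => /borel_open mU; rewrite -(setCK U); exact: measurableC.
Qed.

Section finitely_additive_theory.
Context (R : realType) d (T : measurableType d) (m : set T -> R).
Hypothesis fam : finitely_additive_probability m.

Lemma fap_ge0 S : 0 <= m S. Proof. by case: fam. Qed.

Lemma fap_setT : m setT = 1. Proof. by case: fam. Qed.

Lemma fapU S1 S2 : measurable S1 -> measurable S2 -> S1 `&` S2 = set0 ->
  m (S1 `|` S2) = m S1 + m S2.
Proof. by case: fam => _ _; exact. Qed.

Lemma fap0 : m set0 = 0.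
Proof.
have := fapU (@measurable0 _ T) (@measurable0 _ T) (setI0 _).
by rewrite setU0 => /eqP; rewrite -subr_eq subrr eq_sym => /eqP.
Qed.

Lemma fapD S1 S2 : measurable S1 -> measurable S2 -> S1 `<=` S2 ->
  m S2 = m S1 + m (S2 `\` S1).
Proof.
move=> m1 m2 S12; rewrite -fapU//; last 2 first.
- exact: measurableD.
- by rewrite setDIK.
- by rewrite setDUK.
Qed.

Lemma fapC S : measurable S -> m (~` S) = 1 - m S.
Proof.
move=> mS; apply/esym/eqP; rewrite subr_eq addrC -fapU//.
- by rewrite setUv fap_setT.
- exact: measurableC.
- by rewrite setICr.
Qed.

Lemma le_fap S1 S2 : measurable S1 -> measurable S2 -> S1 `<=` S2 ->
  m S1 <= m S2.
Proof. by move=> m1 m2 S12; rewrite (fapD m1 m2 S12) lerDl fap_ge0. Qed.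

Lemma fap_le1 S : measurable S -> m S <= 1.
Proof. by move=> mS; rewrite -fap_setT le_fap. Qed.

Lemma fapUle S1 S2 : measurable S1 -> measurable S2 ->
  m (S1 `|` S2) <= m S1 + m S2.
Proof.
move=> m1 m2; rewrite -(setDUK (@subsetUl _ S1 S2)) fapU ?setDIK//; last first.
  by apply: measurableD => //; exact: measurableU.
rewrite lerD2l le_fap//; first by apply: measurableD => //; exact: measurableU.
by move=> x [[]].
Qed.

Lemma fap_bigsetU (F : (set T)^nat) n : (forall i, measurable (F i)) ->
  m (\big[setU/set0]_(i < n) F i) <= \sum_(i < n) m (F i).
Proof.
move=> mF; elim: n => [|n IH]; first by rewrite !big_ord0 fap0.
rewrite !big_ord_recr/=; apply: (le_trans (fapUle _ _)) => //.
  by apply: bigsetU_measurable.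
by rewrite lerD2r.
Qed.

End finitely_additive_theory.

Section open_outer_measure.
Context (R : realType) d (T : borelType d) (m : set T -> R).
Hypothesis fam : finitely_additive_probability m.
Hypothesis pnT : perfectly_normal R T.
Local Open Scope ereal_scope.

(** The value [+oo] outside the open sets restricts the covers that count in
    the outer measure to open ones. *)
Definition open_content (S : set T) : \bar R :=
  if `[< open S >] then (m S)%:E else +oo.

Definition open_outer_measure : set T -> \bar R := mu_ext open_content.

Let open_content0 : open_content set0 = 0.
Proof. by rewrite /open_content asboolT ?(fap0 fam)//; exact: open0. Qed.

Let open_content_ge0 S : 0 <= open_content S.
Proof.
by rewrite /open_content; case: ifPn => _; rewrite ?lee_fin ?(fap_ge0 fam).
Qed.

HB.instance Definition _ := isOuterMeasure.Build R T open_outer_measure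
  (mu_ext0 open_content0 open_content_ge0) (mu_ext_ge0 open_content_ge0)
  (le_mu_ext open_content) (mu_ext_sigma_subadditive open_content_ge0).

Local Notation mu := open_outer_measure.

Lemma open_outer_measure_le U : open U -> mu U <= (m U)%:E.
Proof.
move=> oU; pose F k := if k is 0%N then U else set0.
have -> : (m U)%:E = \sum_(k <oo) open_content (F k).
  rewrite nneseries_recl//= eseries_cond/= eseries0 ?adde0; last first.
    by move=> [|k].
  by rewrite /open_content asboolT.
apply: ereal_inf_lbound; exists F => //; split.
  by move=> [|k]//=; exact: borel_open.
by move=> x Ux; exists 0%N.
Qed.

Lemma open_outer_measure_cover E (r : \bar R) : mu E < r -> exists F : (set T)^nat,
  [/\ forall i, open (F i), E `<=` \bigcup_i F i &
      \sum_(i <oo) (m (F i))%:E < r].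
Proof.
move=> /ereal_inf_lt[_ /= [F [mF EF] <-]] sFr; exists F.
have oF i : open (F i).
  apply: contrapT => noF; move: sFr.
  rewrite (eseries_pinfty (k := i)) ?ltNge ?leey//.
  - by move=> k _; rewrite -ltNye (lt_le_trans _ (open_content_ge0 _)).
  - by rewrite /open_content asboolF.
split=> //; apply: le_lt_trans sFr; apply: lee_nneseries => i _ //.
  by move=> _; rewrite lee_fin (fap_ge0 fam).
by rewrite /open_content asboolT.
Qed.

Let openI2 g (t : R) U : open U -> continuous (g : T -> R) ->
  open (U `&` [set x | (t < g x)%R]) /\ open (U `&` [set x | (g x < t)%R]).
Proof.
move=> oU cg; split; apply: openI => //.
  by apply: (@open_comp _ _ g [set x | (t < x)%R]); [move=> + _; exact: cg|exact: open_gt].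
by apply: (@open_comp _ _ g [set x | (x < t)%R]); [move=> + _; exact: cg|exact: open_lt].
Qed.

(** This is where closed sets become measurable although [m] is not countably
    additive: [m (U `\` C)] may exceed the supremum of [m] over the sets
    [V k] of points of [U] with [g > 1 / (k + 1)], which exhaust [U `\` C].
    The outer measure does not see that excess, for [U `\` C] is covered by
    [V n.+1] together with the shells [S k], [k >= n]. As [S k] lies in
    [V k.+2] and misses [V k], its mass is at most [a k.+2 - a k], and these
    bounds telescope to twice the tail of the increasing sequence [a]. *)
Lemma open_outer_measure_split C U : closed C -> open U ->
  mu (U `&` C) + mu (U `\` C) <= (m U)%:E.
Proof.
move=> cC oU; have [g [cg g0 ->]] := pnT cC.
pose t (k : nat) : R := harmonic k.
pose V k := U `&` [set x | (t k < g x)%R].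
pose a k := m (V k).
pose S k := V k.+2 `&` [set x | (g x < t k)%R].
have oV k : open (V k) by have [] := @openI2 g (t k) U oU cg.
have oS k : open (S k) by have [] := @openI2 g (t k) (V k.+2) (oV _) cg.
have mV k : measurable (V k) by exact: borel_open.
have mS k : measurable (S k) by exact: borel_open.
have t_dec k l : (k <= l)%N -> (t l <= t k)%R.
  by move=> kl; rewrite /t /harmonic/= lef_pV2 ?posrE ?ltr0n// ler_nat ltnS.
have t_decS k : (t k.+1 < t k)%R.
  by rewrite /t /harmonic/= ltf_pV2 ?posrE ?ltr0n// ltr_nat.
have a_inc : {homo a : k l / (k <= l)%N >-> (k <= l)%R}.
  move=> k l kl; apply: (le_fap fam) => // x [Ux /= tg]; split => //=.
  by rewrite (le_lt_trans _ tg)// t_dec.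
have a_ub : has_ubound (range a).
  by exists 1%R => _ [k _ <-]; rewrite (fap_le1 fam).
have cva := nondecreasing_cvgn a_inc a_ub.
pose b : R := limn a.
have ab k : (a k <= b)%R.
  by apply: nondecreasing_cvgn_le => //; apply/cvg_ex; eexists; exact: cva.
have Sa k : (m (S k) <= a k.+2 - a k)%R.
  rewrite lerBrDr /a -(fapU fam)//; last first.
    rewrite -subset0 => x [[_ /= gt] [_ /=]] tg.
    by have := lt_trans gt tg; rewrite ltxx.
  apply: (le_fap fam) => //; first exact: measurableU.
  move=> x [[]//|[Ux /= tg]]; split => //=; apply: le_lt_trans tg.
  exact: t_dec (leqW (leqnSn _)).
(* The bounds on even and on odd indices telescope separately. *)
have sumS n N : (\sum_(i < N) m (S (n + i)%N) <= 2 * (b - a n))%R.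
  apply: (@le_trans _ _ ((a (n + N)%N - a n) + (a (n + N).+1 - a n.+1))%R).
    elim: N => [|N IH]; first by rewrite big_ord0 addn0 !subrr addr0.
    rewrite big_ord_recr/=; apply: (le_trans (lerD IH (Sa _))).
    rewrite !addnS; lra.
  have := ab (n + N)%N; have := ab (n + N).+1; have := a_inc _ _ (leqnSn n).
  lra.
apply/lee_addgt0Pr => e e0.
have [n an] : exists n, (b - e / 3 < a n)%R.
  have e3 : (b - e / 3 < b)%R by rewrite ltrBlDr ltrDl divr_gt0.
  have cvb : a @ \oo --> b by apply/cvg_ex; eexists; exact: cva.
  have [n _ /(_ n)] := cvgr_gt _ cvb _ e3.
  by move=> /(_ (leqnn _)) ?; exists n.
(* The part of [U] where [g] is small misses [V n]. *)
have H1 : mu (U `&` [set x | g x = 0%R]) <= (m U - a n)%:E.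
  have [_ oW] := @openI2 g (t n) U oU cg.
  apply: (@le_trans _ _ (mu (U `&` [set x | (g x < t n)%R]))).
    by apply: le_outer_measure => x [Ux /= ->]; split => //=; exact: harmonic_gt0.
  apply: (le_trans (open_outer_measure_le oW)); rewrite lee_fin lerBrDr -(fapU fam)//.
  - apply: (le_fap fam); [|exact: borel_open|by move=> x [[]|[]]].
    by apply: measurableU => //; exact: borel_open.
  - exact: borel_open.
  - rewrite -subset0 => x [[_ /= gt] [_ /=]] tg.
    by have := lt_trans gt tg; rewrite ltxx.
(* A point with [0 < g <= 1 / (n + 2)] belongs to [S (k - 2)] for the least [k]
   with [g > 1 / (k + 1)]. *)
have H2 : mu (U `\` [set x | g x = 0%R]) <= (a n.+1 + 2 * (b - a n))%:E.
  apply: (@le_trans _ _ (mu (V n.+1 `|` \bigcup_i S (n + i)%N))).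
    apply: le_outer_measure => x [Ux /= gx0].
    have gx : (0 < g x)%R by rewrite lt_def g0 andbT; apply/eqP.
    have [|gt] := ltP (t n.+1) (g x); first by left; split.
    right; have exk : exists k, (t k < g x)%R.
      have [k _ /(_ k)] := cvgr_lt _ (@cvg_harmonic R) _ gx.
      by move=> /(_ (leqnn _)) ?; exists k.
    have [k tk kmin] := ex_minnP exk.
    have nk : (n.+1 < k)%N.
      by rewrite ltnNge; apply/negP => /t_dec; rewrite leNgt (lt_le_trans tk gt).
    case: k nk tk kmin => [//|[//|k]]; rewrite !ltnS => nk tk kmin.
    exists (k - n)%N => //; rewrite /S subnKC//; split; first by split.
    rewrite /= (le_lt_trans _ (t_decS k))// leNgt.
    by apply/negP => /kmin; rewrite ltnn.
  apply: (le_trans (outer_measureU2 _ _ _)); rewrite EFinD leeD//.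
    exact: open_outer_measure_le.
  apply: (le_trans (outer_measure_sigma_subadditive _ _)).
  apply: lime_le; first exact: is_cvg_nneseries.
  apply: nearW => N; rewrite big_mkord.
  apply: (@le_trans _ _ (\sum_(i < N) (m (S (n + i)%N))%:E)).
    by apply: lee_sum => i _; exact: open_outer_measure_le.
  by rewrite sumEFin lee_fin.
apply: (le_trans (leeD H1 H2)); rewrite -EFinD lee_fin.
have := ab n.+1; lra.
Qed.

(** Cover an arbitrary set by open sets and split each of them along the
    closed set. *)
Lemma open_outer_measure_caratheodory S : measurable S -> mu.-caratheodory S.
Proof.
rewrite measurable_borelE; apply: smallest_sub.
  split => /=.
  - exact: caratheodory_measurable_set0.
  - by move=> A mA; rewrite setTD; exact: caratheodory_measurable_setC.
  - exact: caratheodory_measurable_bigcup.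
move=> O oO; rewrite -(setCK O); apply: caratheodory_measurable_setC.
have cC := open_closedC oO; move: (~` O) cC => {O oO} C cC.
apply: le_caratheodory_measurable => E.
have [muE|] := eqVneq (mu E) +oo; first by rewrite [leRHS]muE leey.
rewrite -ltey => Efin; apply/lee_addgt0Pr => e e0.
have Er : mu E < mu E + e%:E.
  by rewrite lteDl ?lte_fin// ge0_fin_numE ?outer_measure_ge0.
have [F [oF EF sF]] := open_outer_measure_cover Er; apply: le_trans (ltW sF).
rewrite -setDE.
apply: (@le_trans _ _
    (\sum_(i <oo) mu (F i `&` C) + \sum_(i <oo) mu (F i `\` C))).
  apply: leeD.
    apply: (le_trans _ (outer_measure_sigma_subadditive _ _)).
    by apply: le_outer_measure; rewrite -setI_bigcupl; exact: setSI.
  apply: (le_trans _ (outer_measure_sigma_subadditive _ _)).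
  by apply: le_outer_measure; rewrite -setD_bigcupl; exact: setSD.
rewrite -nneseriesD; try by move=> *; exact: outer_measure_ge0.
apply: lee_nneseries => i _; last exact: open_outer_measure_split.
by move=> _; apply: adde_ge0; exact: outer_measure_ge0.
Qed.

Hypothesis tight : forall e : R, (0 < e)%R ->
  exists K, [/\ compact K, measurable K & (1 - e <= m K)%R].

(** Without tightness mass could escape and [mu] vanish. A compact set of
    nearly full mass is covered by finitely many members of any countable open
    cover, and finite subadditivity of [m] suffices for those. *)
Lemma open_outer_measureT : mu setT = 1.
Proof.
apply/eqP; rewrite eq_le; apply/andP; split.
  by rewrite (le_trans (open_outer_measure_le openT))// (fap_setT fam).
rewrite leNgt; apply/negP => mu1.
have mufin : mu setT \is a fin_num.
  by rewrite ge0_fin_numE ?outer_measure_ge0// (lt_trans mu1) ?ltey.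
move: mu1; rewrite -(fineK mufin); set r := fine _; rewrite lte_fin => r1.
(* With this margin a compact set has mass at least the midpoint of [r] and 1,
   while some open cover has total mass below it. *)
have e0 : (0 < (1 - r) / 2)%R by rewrite divr_gt0// subr_gt0.
have [K [cK mK mK1]] := tight e0.
have : mu setT < (1 - (1 - r) / 2)%:E by rewrite -(fineK mufin) lte_fin -/r; lra.
move=> /open_outer_measure_cover[F [oF TF sF]].
have mF i : measurable (F i) by exact: borel_open.
move: cK; rewrite compact_cover => /(_ nat setT F)[//||D _ KD].
  exact: subset_trans TF.
pose N := (\max_(i <- finmap.enum_fset D) i).+1.
have : (m K <= \sum_(i < N) m (F i))%R.
  apply: le_trans (fap_bigsetU fam N mF); apply: (le_fap fam) => //.
    exact: bigsetU_measurable.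
  rewrite -bigcup_mkord => x /KD[i /= iD Fix]; exists i => //=.
  by rewrite ltnS; exact: (@leq_bigmax_seq _ _ xpredT id).
apply/negP; rewrite -ltNge; apply: lt_le_trans mK1; rewrite -lte_fin.
apply: le_lt_trans sF; rewrite -sumEFin -(big_mkord xpredT (fun i => (m (F i))%:E)).
by apply: nneseries_lim_ge => i _; rewrite lee_fin (fap_ge0 fam).
Qed.

Let mu0 : mu set0 = 0. Proof. exact: outer_measure0. Qed.

Let mu_ge0 S : 0 <= mu S. Proof. exact: outer_measure_ge0. Qed.

Let mu_sigma_additive : semi_sigma_additive (mu : set T -> \bar R).
Proof.
move=> F mF tF mUF.
have cvF := @is_cvg_nneseries R (mu \o F) xpredT 0%N (fun i _ _ => mu_ge0 (F i)).
suff <- : \sum_(i <oo) mu (F i) = mu (\bigcup_n F n) by [].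
apply/eqP; rewrite eq_le outer_measure_sigma_subadditive andbT.
have carF n := open_outer_measure_caratheodory (mF n).
have := caratheodory_lime_le carF tF (\bigcup_k F k).
rewrite setICr outer_measure0 adde0; apply: le_trans.
apply: lee_nneseries => i _; first by move=> _; exact: mu_ge0.
by apply: le_outer_measure => x Fx; split => //; exists i.
Qed.

Let P (S : set T) : \bar R := mu S.

HB.instance Definition _ := isMeasure.Build _ T R P mu0 mu_ge0 mu_sigma_additive.

HB.instance Definition _ := Measure_isProbability.Build _ T R P open_outer_measureT.

(** The outer measure is already a measure on the Borel sets, all of them being
    measurable in the sense of Caratheodory. *)
Lemma finitely_additive_regularization : exists mu : probability T R,
  forall U, open U -> mu U <= (m U)%:E.
Proof. by exists P; exact: open_outer_measure_le. Qed.

End open_outer_measure.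

(** * Comparing a finitely additive probability with its regularization *)

Section regularization.
Context (R : realType) d (T : borelType d).

Lemma fap_probability (mu : probability T R) :
  finitely_additive_probability (fun S => fine (mu S)).
Proof.
split=> [S||S1 S2 m1 m2 S12]; first exact: fine_ge0.
- by rewrite probability_setT.
- by rewrite measureU// fineD// fin_num_measure.
Qed.

Variable m : set T -> R.
Hypothesis fam : finitely_additive_probability m.
Variable mu : probability T R.
Hypothesis mu_open : forall U, open U -> (mu U <= (m U)%:E)%E.

Let p S : R := fine (mu S).

Let fap : finitely_additive_probability p := fap_probability mu.

Let muE S : measurable S -> mu S = (p S)%:E.
Proof. by move=> mS; rewrite /p fineK// fin_num_measure. Qed.

Lemma regularization_open U : open U -> p U <= m U.
Proof.
by move=> oU; rewrite -lee_fin -muE ?mu_open//; exact: borel_open.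
Qed.

Lemma regularization_closed C : closed C -> m C <= p C.
Proof.
move=> cC; have mC := borel_closed cC; have := regularization_open (closed_openC cC).
by rewrite !fapC// lerD2l lerN2.
Qed.

Section dominated.
Hypothesis pnT : perfectly_normal R T.
Variable W : set T.
Hypothesis oW : open W.
Hypothesis dom : forall e : R, 0 < e ->
  exists2 l : {measure set T -> \bar R}, (l setT < +oo)%E &
    forall S, measurable S -> S `<=` W -> ((m S)%:E <= l S + e%:E)%E.

Let mW : measurable W := borel_open oW.

Let finite_measure_cvg0 (l : {measure set T -> \bar R}) (F : (set T)^nat) :
  (l setT < +oo)%E ->
  (forall n, measurable (F n)) -> (forall n, F n.+1 `<=` F n) ->
  \bigcap_n F n = set0 ->
  forall e : R, 0 < e -> exists N, forall n, (N <= n)%N -> (l (F n) <= e%:E)%E.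
Proof.
move=> lT mF decF F0 e e0.
have lfin n : l (F n) \is a fin_num.
  by rewrite ge0_fin_numE// (le_lt_trans _ lT)// le_measure// inE.
have : l \o F @ \oo --> l (\bigcap_n F n).
  apply: nonincreasing_cvg_mu => //.
  - by rewrite ltey_eq lfin.
  - exact: bigcapT_measurable.
  - by apply/nonincreasing_seqP => n; apply/subsetPset.
rewrite F0 measure0 => /fine_cvgP[_ /cvgr_le/(_ _ e0)[N _ NF]]; exists N => n Nn.
by rewrite -[leLHS]fineK// lee_fin; exact: NF.
Qed.

(** Domination by a finite measure up to arbitrarily small errors makes [m]
    continuous at the empty set along sets contained in [W]. *)
Let dom_cvg0 (F : (set T)^nat) : (forall n, measurable (F n)) ->
  (forall n, F n `<=` W) -> (forall n, F n.+1 `<=` F n) ->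
  \bigcap_n F n = set0 -> forall e : R, 0 < e -> exists n, m (F n) + p (F n) <= e.
Proof.
move=> mF FW decF F0 e e0; have e3 : 0 < e / 3 by rewrite divr_gt0.
have [l lT lm] := dom e3.
have muT : (mu setT < +oo)%E by rewrite probability_setT ltry.
have [N1 H1] := finite_measure_cvg0 lT mF decF F0 e3.
have [N2 H2] := finite_measure_cvg0 muT mF decF F0 e3.
pose n := maxn N1 N2; exists n.
have := lm _ (mF n) (FW n).
move=> /le_trans/(_ (leeD2r _ (H1 n (leq_maxl _ _)))); rewrite -EFinD lee_fin.
have := H2 n (leq_maxr _ _).
rewrite -[leLHS]fineK ?fin_num_measure// lee_fin -/(p _); lra.
Qed.

Let eq_W := fun S => m (S `&` W) = p (S `&` W).

(** Inner approximation of an open set by the closed sets [{g >= 1 / (n + 1)}],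
    on which [m] is below [mu]; the remainders decrease to the empty set. *)
Let eq_W_open U : open U -> eq_W U.
Proof.
rewrite /eq_W => oU; have := openI oU oW; have : U `&` W `<=` W by [].
move: (U `&` W) => {oU}U UW oU.
have mU := borel_open oU.
apply/eqP; rewrite eq_le regularization_open// andbT.
apply/ler_addgt0Pr => e e0.
have [g [cg g0 Ug]] := pnT (open_closedC oU).
have ming (t : R) : open [set x | g x < t].
  by apply: (@open_comp _ _ g [set x | x < t]); [move=> + _; exact: cg|exact: open_lt].
have mF n : measurable (U `&` [set x | g x < harmonic n]).
  by apply: measurableI => //; apply: borel_open; exact: ming.
have [|||n Fn] := dom_cvg0 mF _ _ _ e0.
- by move=> n x [/UW].
- move=> n x [Ux /= gx]; split => //=; apply: lt_trans gx _.
  by rewrite ltf_pV2 ?posrE// ltr_nat.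
- rewrite -subset0 => x H /=; have [Ux _] := H 0%N I.
  have gx : 0 < g x.
    rewrite lt_def g0 andbT; apply/eqP => gx0.
    by have : (~` U) x by rewrite Ug.
  have [k _ /(_ k)] := cvgr_lt _ (@cvg_harmonic R) _ gx.
  by move=> /(_ (leqnn _)) kg; have [_ /=] := H k I; rewrite ltNge ltW.
rewrite (fapD fam (mF n) mU)//.
have /regularization_closed : closed (~` [set x | g x < harmonic n]).
  exact: open_closedC (ming _).
have -> : ~` [set x | g x < harmonic n] = U `\` (U `&` [set x | g x < harmonic n]).
  apply/seteqP; split=> [x /= gx|x [Ux] nUg gx]; last exact: nUg.
  have Ux : U x.
    apply: contrapT => nUx; apply: gx; have : (~` U) x by [].
    by rewrite Ug /= => ->; rewrite harmonic_gt0.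
  by split=> // -[].
have mD : measurable (U `\` (U `&` [set x | g x < harmonic n])) by exact: measurableD.
move=> H; have := le_fap fap mD mU (@subDsetl _ _ _).
have := fap_ge0 fap (U `&` [set x | g x < harmonic n]).
move: H Fn; rewrite /=; lra.
Qed.

(** Two set functions that are continuous at the empty set inside [W] and agree
    on its open subsets agree on its Borel subsets, by Dynkin's lemma. *)
Lemma regularization_dominated S : measurable S -> S `<=` W -> m S = p S.
Proof.
move=> mS SW; have -> : S = S `&` W by apply/esym/setIidPl.
move: mS; rewrite measurable_borelE.
apply: (@dynkin_induction _ T (@open T) eq_W); first exact: measurable_borelE.
- by move=> A B; exact: openI.
- by apply: eq_W_open; exact: openT.
- exact: eq_W_open.
- rewrite /eq_W => A mA AW.
  have mAW := measurableI _ _ mA mW.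
  have := fapD fam mAW mW (@subIsetr _ _ _).
  have := fapD fap mAW mW (@subIsetr _ _ _).
  have := eq_W_open openT; rewrite /eq_W setTI => -> ->.
  by rewrite AW setDIr setDv setU0 setDE [W `&` _]setIC => /addrI.
- move=> F mF tF PF; rewrite /eq_W; set B := _ `&` W.
  have mB : measurable B by apply: measurableI => //; exact: bigcup_measurable.
  pose H n := \big[setU/set0]_(i < n) F i `&` W.
  have mbF n : measurable (\big[setU/set0]_(i < n) F i) by exact: bigsetU_measurable.
  have mH n : measurable (H n) by exact: measurableI.
  have HB n : H n `<=` B by apply: setSI; exact: bigsetU_bigcup.
  have HE n : m (H n) = p (H n).
    elim: n => [|n IH]; first by rewrite /H big_ord0 set0I (fap0 fam) (fap0 fap).
    rewrite /H big_ord_recr/= setIUl.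
    have H0 : (\big[setU/set0]_(i < n) F i `&` W) `&` (F n `&` W) = set0.
      rewrite setIACA setIid (@trivIset_bigsetUI _ predT) ?set0I//.
      by apply: sub_trivIset tF.
    have mFn : measurable (F n `&` W) by exact: measurableI.
    by rewrite (fapU fam (mH n) mFn H0) (fapU fap (mH n) mFn H0) IH PF.
  have mG n : measurable (B `\` H n) by exact: measurableD.
  apply/eqP; rewrite -subr_eq0 -normr_le0; apply/ler_addgt0Pl => e e0.
  have [|||n Gn] := dom_cvg0 mG _ _ _ e0.
  + by move=> n x [[]].
  + move=> n x [Bx nHx]; split=> // -[Hx Wx]; apply: nHx; split=> //.
    by rewrite big_ord_recr/=; left.
  + rewrite -subset0 => x Gx; have [[[k _ Fkx] Wx] _] := Gx 0%N I.
    have [_ []] := Gx k.+1 I; split=> //.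
    by rewrite big_ord_recr/=; right.
  rewrite (fapD fam (mH n) mB)// (fapD fap (mH n) mB)// HE.
  have m0 := fap_ge0 fam (B `\` H n).
  have p0 : 0 <= p (B `\` H n) := fap_ge0 fap _.
  by move: Gn; rewrite addr0 ler_norml => Gn; apply/andP; split; lra.
Qed.

End dominated.

(** Up to an error [e], everything happens in the open set [E]. There [m] and
    [mu] agree off [D], so the inequality [mu (V `&` E) <= m (V `&` E)] for
    the open set [V] subtracts to the same inequality on [D], where [V] and
    [B] coincide. *)
Lemma regularization_relatively_open B : measurable B ->
  (forall e : R, 0 < e -> exists K E D V,
    [/\ [/\ closed K, open E & K `<=` E] /\ m (~` K) <= e, closed D,
        forall S, measurable S -> S `<=` E `\` D -> m S = p S,
        open V & B `&` D = V `&` D]) ->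
  p B <= m B.
Proof.
move=> mB H; apply/ler_addgt0Pr => e e0.
have [K [E [D [V [[[cK oE KE] mK] cD eqW oV BV]]]]] := H _ e0.
have [mE mD mV] := And3 (borel_open oE) (borel_closed cD) (borel_open oV).
have [mKm mVE] := (borel_closed cK, measurableI _ _ mV mE).
have pE : p (~` E) <= e.
  apply: le_trans mK; apply: (@le_trans _ _ (p (~` K))).
    by apply: (le_fap fap); [exact: measurableC..|exact: subsetC].
  by apply: regularization_open; exact: closed_openC.
have mBE := measurableI _ _ mB mE.
have split2 (q : set T -> R) S : finitely_additive_probability q ->
    measurable S -> q (S `&` E) = q (S `&` E `\` D) + q (S `&` E `&` D).
  move=> fq mS; have mSE := measurableI _ _ mS mE.
  rewrite -(fapU fq) //.
  - by rewrite setDE -setIUr setvU setIT.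
  - exact: measurableD.
  - exact: measurableI.
  - by rewrite -subset0 => x [[_ nD] [_]].
have pVE := regularization_open (openI oV oE).
have eqD S : measurable S -> m (S `&` E `\` D) = p (S `&` E `\` D).
  move=> mS; apply: eqW; last by move=> x [[]].
  by apply: measurableD => //; exact: measurableI.
have := split2 _ _ fam mV; have := split2 _ _ fap mV.
have := split2 _ _ fam mB; have := split2 _ _ fap mB.
rewrite !eqD// [B `&` E `&` D]setIAC BV [V `&` D `&` E]setIAC => H1 H2 H3 H4.
have := le_fap fam mBE mB (@subIsetl _ _ _).
have : p B <= p (B `&` E) + p (~` E).
  have mEc := measurableC mE.
  apply: le_trans (fapUle fap mBE mEc); apply: (le_fap fap) => //.
    exact: measurableU.
  by move=> x Bx; have [Ex|nEx] := pselect (E x); [left|right].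
lra.
Qed.

End regularization.

(** A closed set [{g = 0}] is the intersection of the closed sets
    [{g <= 1 / (n + 1)}]. On these [mu2] is above [m], while [m] is above [mu1]
    on the open sets [{g < 1 / (n + 1)}] contained in them: hence
    [mu1 <= mu2] on closed sets, and the roles can be exchanged. *)
Lemma regularization_unique (R : realType) d (T : borelType d) (m : set T -> R)
    (mu1 mu2 : probability T R) :
  finitely_additive_probability m -> perfectly_normal R T ->
  (forall U, open U -> mu1 U <= (m U)%:E)%E ->
  (forall U, open U -> mu2 U <= (m U)%:E)%E ->
  forall S, measurable S -> mu1 S = mu2 S.
Proof.
move=> fam pnT; wlog suff : mu1 mu2 / forall U,
    (forall U, open U -> mu1 U <= (m U)%:E)%E ->
    (forall U, open U -> mu2 U <= (m U)%:E)%E -> open U -> (mu2 U <= mu1 U)%E.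
  move=> H m1 m2 S; rewrite measurable_borelE.
  apply: (@dynkin_induction _ T (@open T) (fun S => mu1 S = mu2 S)).
  - exact: measurable_borelE.
  - by move=> A B; exact: openI.
  - by rewrite !probability_setT.
  - by move=> U oU; apply/eqP; rewrite eq_le !H.
  - by move=> A mA A12; rewrite !probability_setC// A12.
  - move=> F mF tF F12; rewrite !measure_bigcup//.
    by apply: eq_eseriesr => n _; exact: F12.
move=> U m1 m2 oU; have [g [cg g0 Ug]] := pnT _ (open_closedC oU).
pose F n := [set x | g x <= harmonic n].
have cF n : closed (F n).
  by apply: (@closed_comp _ _ g [set x | x <= harmonic n]) => //; exact: closed_le.
have oF n : open [set x | g x < harmonic n].
  by apply: (@open_comp _ _ g [set x | x < harmonic n]); [move=> + _; exact: cg|exact: open_lt].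
have mF n := borel_closed (cF n).
have decF : nonincreasing_seq F.
  apply/nonincreasing_seqP => n; apply/subsetPset => x /= /le_trans; apply.
  by rewrite lef_pV2 ?posrE// ler_nat.
have FE : \bigcap_n F n = ~` U.
  rewrite Ug; apply/seteqP; split=> [x Fx /=|x /= gx0 n _]; last first.
    by rewrite /F/= gx0 harmonic_ge0.
  apply/eqP; rewrite eq_le g0 andbT; apply: (cvgr_to_ge (@cvg_harmonic R)).
  by apply: nearW => n; exact: Fx.
have mU := borel_open oU.
have : mu2 \o F @ \oo --> mu2 (~` U).
  rewrite -FE; apply: nonincreasing_cvg_mu => //.
    by rewrite ltey_eq fin_num_measure.
  exact: bigcapT_measurable.
have : (mu1 (~` U) <= mu2 (~` U))%E -> (mu2 U <= mu1 U)%E.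
  rewrite !probability_setC// -(fineK (fin_num_measure mu1 _ mU)).
  rewrite -(fineK (fin_num_measure mu2 _ mU)) -!EFinB !lee_fin.
  by rewrite lerD2l lerN2.
move=> H cv; apply: H; apply: (cvge_to_ge cv); apply: nearW => n /=.
apply: (@le_trans _ _ (mu1 [set x | g x < harmonic n])).
  apply: le_measure; rewrite ?inE; [exact: measurableC|exact: borel_open|].
  by rewrite Ug => x /= ->; exact: harmonic_gt0.
apply: (le_trans (m1 _ (oF n))); apply: (@le_trans _ _ (m (F n))%:E).
  rewrite lee_fin (le_fap fam)//; first exact: borel_open.
  by move=> x /ltW.
rewrite -[leRHS]fineK ?fin_num_measure// lee_fin.
by apply: (regularization_closed fam m2).
Qed.

(** * Integrals under setwise limits of probabilities *)

Section unit_layers.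
Context (R : realType) (T : Type).
Local Open Scope ereal_scope.
Implicit Type f : T -> \bar R.

(** The number of layers containing [x] is [f x] rounded up. *)
Definition layer f (n : nat) : set T := [set x | n%:R%:E < f x].

Lemma layers_le f (K : nat) x : 0 <= f x ->
  \sum_(n < K) (\1_(layer f n) x)%:E <= f x + 1.
Proof.
move=> f0; elim: K => [|K IH]; first by rewrite big_ord0 adde_ge0.
have layersK : \sum_(n < K) (\1_(layer f n) x : R)%:E <= K%:R%:E.
  rewrite sumEFin lee_fin; apply: (@le_trans _ _ (\sum_(n < K) 1)%R).
    by apply: ler_sum => i _; rewrite indicE lern1 leq_b1.
  by rewrite sumr_const card_ord.
rewrite big_ord_recr/= indicE; case: (boolP (_ \in _)) => [|_].
  by rewrite inE /layer/= => Kf; rewrite leeD// (le_trans layersK)// ltW.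
by rewrite adde0.
Qed.

Lemma le_layers f x : 0 <= f x -> f x <= \sum_(n <oo) (\1_(layer f n) x)%:E.
Proof.
move=> f0; have ge0 n : 0 <= (\1_(layer f n) x : R)%:E by rewrite lee_fin.
have sumK (K : nat) : (forall n, (n < K)%N -> n%:R%:E < f x) ->
    K%:R%:E <= \sum_(n <oo) (\1_(layer f n) x : R)%:E.
  move=> Kf; apply: (@le_trans _ _ (\sum_(0 <= n < K) (\1_(layer f n) x : R)%:E)).
    rewrite big_mkord (eq_bigr (fun=> 1)).
      by rewrite sumEFin sumr_const card_ord.
    by move=> i _; rewrite indicE mem_set//; exact: Kf.
  by apply: nneseries_lim_ge => n _.
case fx : (f x) f0 => [r| |]//.
- rewrite lee_fin => r0; have exK : exists K, (r <= K%:R)%R.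
    by exists (Num.truncn r).+1; rewrite ltW// truncnS_gt.
  have [K rK minK] := ex_minnP exK.
  apply: (@le_trans _ _ K%:R%:E); first by rewrite lee_fin.
  apply: sumK => n nK; rewrite fx lte_fin ltNge; apply/negP => /minK.
  by rewrite leqNgt nK.
- move=> _; rewrite leye_eq; apply/eqP/eqyP => A A0.
  apply: le_trans (sumK (Num.truncn A).+1 _); last by move=> n _; rewrite fx ltey.
  by rewrite lee_fin ltW// truncnS_gt.
Qed.

End unit_layers.

Section ultralimit_measure.
Context (R : realType) d (T : measurableType d).
Variables (G : set_system (probability T R)) (UG : UltraFilter G).

Definition ulim_measure (S : set T) : R :=
  ulim G (fun nu : probability T R => fine (nu S)).

Lemma ulim_measure_cvg S : measurable S ->
  (fun nu : probability T R => fine (nu S)) @ G --> ulim_measure S.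
Proof.
move=> mS; apply: (ulim_cvg (c := 1)); apply: nearW => nu.
rewrite ger0_norm ?fine_ge0// -lee_fin fineK ?fin_num_measure//.
exact: probability_le1.
Qed.

Lemma ulim_measure_fap : finitely_additive_probability ulim_measure.
Proof.
split=> [S||S1 S2 m1 m2 S12].
- have [mS|nmS] := pselect (cvg ((fun nu : probability T R => fine (nu S)) @ G)).
    by apply: limr_ge => //; apply: nearW => nu; exact: fine_ge0.
  rewrite /ulim_measure /ulim dvgP//.
- apply: ulim_unique; under eq_fun do rewrite probability_setT /=.
  exact: cvg_cst.
- apply: ulim_unique.
  under eq_fun do rewrite measureU// fineD ?fin_num_measure//.
  by apply: cvgD; exact: ulim_measure_cvg.
Qed.

Local Open Scope ereal_scope.

(** The integral of [f] lies within 1 of the sum of the masses of its unit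
    layers. Finitely many layers pass to the limit along [G]; applied to
    [N * f], the error becomes [1 / N]. *)
Lemma integral_le_layers (mu : probability T R) (f : T -> \bar R) (k : R) :
  measurable_fun setT f -> (forall x, 0 <= f x) ->
  (forall t : R, (0 <= t)%R ->
     (fine (mu [set x | (t%:E < f x)%E]) <=
      ulim_measure [set x | (t%:E < f x)%E])%R) ->
  (forall e : R, (0 < e)%R -> \forall nu \near G,
     \int[nu : probability T R]_x f x <= (k + e)%:E) ->
  \int[mu]_x f x <= k%:E.
Proof.
move=> mf f0 mum fk.
suff H (N : nat) : (0 < N)%N -> \int[mu]_x f x <= (k + N%:R^-1)%:E.
  apply/lee_addgt0Pr => e e0; have [n] := ltr_add_invr e0.
  rewrite add0r => /ltW ne; apply: (le_trans (H n.+1 isT)).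
  by rewrite -EFinD lee_fin lerD2l.
move=> N0; have N0' : (0 < N%:R :> R)%R by rewrite ltr0n.
(* Refine the layers by the factor [N]. *)
pose g x := N%:R%:E * f x.
have g0 x : 0 <= g x by rewrite mule_ge0.
have mg : measurable_fun setT g by exact: measurable_funeM.
have gE n : layer g n = [set x | (n%:R / N%:R)%:E < f x].
  by apply/seteqP; split=> x; rewrite /layer /g /= EFinM lte_pdivrMr// muleC.
have mL n : measurable (layer g n).
  by rewrite /layer -[X in measurable X]setTI; exact: emeasurable_fun_o_infty.
have intL (nu : probability T R) n : \int[nu]_x (\1_(layer g n) x)%:E =
    (fine (nu (layer g n)))%:E.
  by rewrite integral_indic// setIT fineK// fin_num_measure.
have sumL K : (\sum_(n < K) ulim_measure (layer g n) <= N%:R * k + 1)%R.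
  apply/ler_addgt0Pr => e e0.
  have eN : (0 < e / N%:R)%R by rewrite divr_gt0.
  have cvS : (fun nu : probability T R => \sum_(n < K) fine (nu (layer g n)))%R @ G
      --> (\sum_(n < K) ulim_measure (layer g n))%R.
    by apply: cvg_big => [|n _]; [exact: add_continuous|exact: ulim_measure_cvg].
  apply: (cvgr_to_le cvS); near=> nu.
  rewrite -lee_fin -sumEFin; under eq_bigr do rewrite -intL.
  rewrite -ge0_integral_sum//; last first.
    by move=> n; apply/measurable_EFinP; exact: measurable_indic.
  apply: (@le_trans _ _ (\int[nu]_x (g x + 1))).
    apply: ge0_le_integral => //.
    - by move=> x _; apply: sume_ge0 => n _; rewrite lee_fin.
    - apply: emeasurable_sum => n; apply/measurable_EFinP.
      exact: measurable_indic.
    - exact: emeasurable_funD.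
    - by move=> x _; exact: layers_le.
  have int1 : \int[nu]_x (cst 1 x) = 1.
    by rewrite integral_cst// mul1e; exact: probability_setT.
  rewrite ge0_integralD// int1.
  rewrite ge0_integralZl//.
  have : \int[nu]_x f x <= (k + e / N%:R)%:E by near: nu; exact: fk.
  move=> /(lee_wpmul2l (x := N%:R%:E)) H.
  apply: (le_trans (leeD (H _) (lexx _))); first by rewrite lee_fin.
  rewrite -EFinM -EFinD lee_fin mulrDr mulrCA divff ?gt_eqF// mulr1.
  by rewrite -!addrA [(e + 1)%R]addrC.
have : \int[mu]_x g x <= (N%:R * k + 1)%:E.
  apply: (@le_trans _ _ (\int[mu]_x \sum_(n <oo) (\1_(layer g n) x)%:E)).
    apply: ge0_le_integral => //.
    - apply: ge0_emeasurable_sum => [n x _|n _]; first by rewrite lee_fin.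
      by apply/measurable_EFinP; exact: measurable_indic.
    - by move=> x _; exact: le_layers.
  rewrite integral_nneseries//; last first.
    by move=> n; apply/measurable_EFinP; exact: measurable_indic.
  apply: lime_le.
    by apply: is_cvg_nneseries => n _ _; apply: integral_ge0 => x _; rewrite lee_fin.
  apply: nearW => K; rewrite big_mkord; under eq_bigr do rewrite intL.
  rewrite sumEFin lee_fin; apply: le_trans (sumL K); apply: ler_sum => n _.
  by rewrite gE; apply: mum; rewrite divr_ge0.
rewrite ge0_integralZl// muleC -lee_pdivlMr// => /le_trans; apply.
by rewrite -EFinM lee_fin mulrDl mul1r mulrAC divff ?gt_eqF// mul1r.
Unshelve. all: by end_near. Qed.

End ultralimit_measure.

(** * Topology and Borel sets of a product with a countable discrete space *)

Lemma borel_space_hausdorff (R : realType) (X : topologicalType) :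
  borel_space R X -> hausdorff_space X.
Proof.
move=> [Y [B [f [g [_ _ [_ gf] cf _]]]]] x y xy.
apply: (can_inj gf); apply: (@metric_hausdorff R Y) => U V Ux Vy.
have [z [Uz Vz]] := xy (f @^-1` U) (f @^-1` V) (cf _ _ Ux) (cf _ _ Vy).
by exists (f z).
Qed.

(** Pull back the distance to the image of [C] in the ambient metric space. It
    vanishes on [C] only, because [C] is closed and the inverse of the
    embedding is continuous on its range. *)
Lemma borel_space_perfectly_normal (R : realType) (X : topologicalType) :
  borel_space R X -> perfectly_normal R X.
Proof.
move=> [Y [B [f [g [_ _ [[fB _ _] gf] cf cg]]]]] C cC.
have [->|/set0P[c0 Cc0]] := eqVneq C set0.
  exists (cst 1); split=> [x|x|]; [exact: cvg_cst|exact: ler01|].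
  by apply/seteqP; split=> x //= /eqP; rewrite oner_eq0.
pose D := f @` C; pose dC y := @edist_inf R Y D y.
have dfin y : dC y \is a fin_num.
  rewrite ge0_fin_numE ?edist_inf_ge0//.
  apply: (@le_lt_trans _ _ (@edist R Y (y, f c0))).
    by apply: ereal_inf_lbound; exists (f c0) => //; exists c0.
  rewrite -ge0_fin_numE ?edist_ge0//; apply/edist_finP.
  exists (mdist y (f c0) + 1); first by rewrite ltr_wpDl// mdist_ge0.
  by rewrite /= ballEmdist/= ltrDl.
exists (fun x => fine (dC (f x))); split.
- move=> x; apply: (@continuous_comp _ _ _ f (fine \o dC)); first exact: cf.
  by apply: fine_cvg; rewrite fineK//; exact: edist_inf_continuous.
- by move=> x; rewrite fine_ge0// edist_inf_ge0.
apply/seteqP; split=> [x Cx /=|x /= dx0].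
  by rewrite /dC edist_inf0//; exists x.
have {}dx0 : dC (f x) = 0%E by rewrite -(fineK (dfin _)) dx0.
rewrite (closure_id C).1// => U Ux.
move/subspace_continuousP : cg => /(_ (f x) (fB _ I) U) /=.
rewrite /from_subspace gf nbhs_filterE /= => /(_ Ux) wU.
have /nbhs_ballP[e /= e0 eU] : nbhs (f x) [set y | B y -> U (g y)] by exact: wU.
have : (dC (f x) < e%:E)%E by rewrite dx0 lte_fin.
move=> /ereal_inf_lt[_ [_ [c Cc <-] <-]] de; exists c; split=> //.
rewrite -(gf c); apply: (eU (f c)); last exact: fB.
exact: (@edist_lt_ball R Y e (f x, f c)).
Qed.

Lemma open_setXT (X Y : topologicalType) (U : set X) :
  open U -> open (U `*` [set: Y]).
Proof.
by rewrite setXT => oU; apply: open_comp => // z _; exact: cvg_fst.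
Qed.

Lemma closed_setXT (X Y : topologicalType) (C : set X) :
  closed C -> closed (C `*` [set: Y]).
Proof.
by rewrite setXT => cC; apply: closed_comp => // z _; exact: cvg_fst.
Qed.

Section discrete_product.
Context (R : realType) dX dA (X : borelType dX) (A : borelType dA).
Hypothesis dscA : discrete_space A.
Hypothesis cntA : countable [set: A].

Lemma measurable_discrete (B : set A) : measurable B.
Proof. exact/borel_open/dscA. Qed.

Lemma continuous_pairl (a : A) : continuous (fun x : X => (x, a)).
Proof. by move=> x; apply: cvg_pair => //=; exact: cvg_cst. Qed.

Lemma nbhs_discrete_prod (x : X) (a : A) (U : set (X * A)) :
  nbhs x (fun y => U (y, a)) -> nbhs (x, a) U.
Proof.
move=> xU; exists ((fun y => U (y, a)), [set a]).
  split => //=; apply: open_nbhs_nbhs; split => //; exact: dscA.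
by move=> [y b] /= [Uy ->].
Qed.

Lemma open_prod_measurable (U : set (X * A)) : open U -> measurable U.
Proof.
move=> oU; pose S a := (fun x : X => (x, a)) @^-1` U.
have -> : U = \bigcup_a (S a `*` [set a]).
  apply/seteqP; split=> [[x a] Ux|[x a] [b _ [/= Sx ->]]] //.
  by exists a.
apply: countable_bigcupT_measurable => // a.
apply: measurableX; last exact: measurable_discrete.
apply: borel_open; apply: open_comp => // x _; exact: continuous_pairl.
Qed.

Lemma prod_borelE : @measurable _ (X * A)%type = <<s @open (X * A)%type >>.
Proof.
apply/seteqP; split; last first.
  apply: smallest_sub; first exact: sigma_algebra_measurable.
  exact: open_prod_measurable.
have [s0 sC sU] := @smallest_sigma_algebra (X * A)%type setT open.
apply: smallest_sub => // U [|] [B mB <-]; rewrite setTI.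
- move: mB; rewrite measurable_borelE; move: B; apply: smallest_sub.
    split => /=.
    + by rewrite preimage_set0.
    + by move=> B /sC; rewrite !setTD preimage_setC.
    + by move=> F HF; rewrite preimage_bigcup; exact: sU.
  move=> O oO; apply: sub_sigma_algebra; apply: open_comp => // z _.
  exact: cvg_fst.
- apply: sub_sigma_algebra; apply: open_comp => [z _|]; first exact: cvg_snd.
  exact: dscA.
Qed.

(** A function on the product with a discrete space is continuous as soon as
    its sections are, so the sections can be treated one by one. *)
Lemma prod_perfectly_normal :
  perfectly_normal R X -> perfectly_normal R (X * A)%type.
Proof.
move=> pnX C cC; pose S a := (fun x : X => (x, a)) @^-1` C.
have /choice[g gP] a : exists g : X -> R,
    [/\ continuous g, forall x, 0 <= g x & S a = [set x | g x = 0]].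
  apply: pnX; apply: closed_comp => // x _; exact: continuous_pairl.
exists (fun z => g z.2 z.1); split.
- move=> [x a] U gU; apply: nbhs_discrete_prod; have [cg _ _] := gP a.
  exact: cg.
- by move=> z; have [_ g0 _] := gP z.2.
- apply/seteqP; split=> -[x a]; have [_ _ /seteqP[Sg gS]] := gP a.
    exact: (Sg x).
  exact: (gS x).
Qed.

Lemma prod_hausdorff : hausdorff_space X -> hausdorff_space (X * A)%type.
Proof.
move=> hX [x a] [y b] xy; have -> : x = y.
  apply: hX => U V Ux Vy.
  have [] := xy (fst @^-1` U) (fst @^-1` V).
  - exact: (@cvg_fst _ _ (nbhs x) (nbhs a)).
  - exact: (@cvg_fst _ _ (nbhs y) (nbhs b)).
  by move=> [z c] [/= Uz Vz]; exists z.
have n1 (u : X) (c : A) : nbhs (u, c) (snd @^-1` [set c]).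
  by apply: nbhs_discrete_prod; exact: nearW.
by have [[u c] [/= <- <-]] := xy _ _ (n1 x a) (n1 y b).
Qed.

Lemma compact_finite_actions (K : set (X * A)) : compact K ->
  finite_set (snd @` K).
Proof.
move=> cK; have : compact (snd @` K).
  by apply: continuous_compact => //; apply: continuous_subspaceT => z; exact: cvg_snd.
rewrite compact_cover => /(_ A setT (fun a => [set a]))[].
- by move=> a _; exact: dscA.
- by move=> a _; exists a.
- move=> D _ KD; apply: sub_finite_set (finite_fset D).
  by move=> a /KD[b /= bD ->].
Qed.

End discrete_product.

(** * Integration against a kernel *)

Section mixture.
Context (R : realType) d d' (T : measurableType d) (X : measurableType d').
Variables (P : probability T R) (q : R.-pker T ~> X).
Local Open Scope ereal_scope.

Definition mixture (B : set X) : \bar R := \int[P]_z q z B.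

Let cst_kernel : R.-pker unit ~> T :=
  kprobability (measurable_cst (P : pprobability T R)).

Let mixtureE : mixture = kcomp cst_kernel (kernel.kernel_snd q) tt.
Proof. by []. Qed.

Let mixture0 : mixture set0 = 0.
Proof. by rewrite mixtureE measure0. Qed.

Let mixture_ge0 B : 0 <= mixture B.
Proof. by rewrite mixtureE measure_ge0. Qed.

Let mixture_sigma_additive : semi_sigma_additive mixture.
Proof. by rewrite mixtureE; exact: measure_semi_sigma_additive. Qed.

HB.instance Definition _ := isMeasure.Build _ _ _ mixture
  mixture0 mixture_ge0 mixture_sigma_additive.

Let mixture_setT : mixture setT = 1.
Proof.
rewrite /mixture (eq_integral (cst 1)); last by move=> z _; exact: prob_kernel.
by rewrite integral_cst// mul1e; exact: probability_setT.
Qed.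

HB.instance Definition _ := Measure_isProbability.Build _ _ _ mixture mixture_setT.

Lemma integral_mixture (f : X -> \bar R) :
  (forall x, 0 <= f x) -> measurable_fun setT f ->
  \int[mixture]_x f x = \int[P]_z \int[q z]_x f x.
Proof.
move=> f0 mf.
rewrite -[RHS](@integral_kcomp _ _ _ _ _ _ R cst_kernel (kernel.kernel_snd q) tt f f0 mf).
by apply: eq_measure_integral.
Qed.

End mixture.

Lemma measurable_integral_kernel (R : realType) d d' (T : measurableType d)
    (X : measurableType d') (q : R.-pker T ~> X) (f : X -> \bar R) :
  (forall x, (0 <= f x)%E) -> measurable_fun setT f ->
  measurable_fun setT (fun z => \int[q z]_x f x)%E.
Proof.
by move=> f0 mf; apply: measurable_fun_integral_kernel => // U mU; exact: measurable_kernel.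
Qed.

(** * Semicontinuity of a weakly continuous kernel on open sets *)

Section weak_continuity.
Context (R : realType) dX dA (X : borelType dX) (A : borelType dA).
Variable q : R.-pker (X * A) ~> X.
Variable D : set (X * A).
Hypothesis cq : {within D, continuous (kernel_probability q)}.

(** The map [q] into the space of probabilities composed with the evaluation
    at [f], continuous for the weak topology by definition of the latter. *)
Lemma continuous_kernel_integral (f : X -> R) (c : R) : continuous f ->
  (forall x, `|f x| <= c) ->
  {within D, continuous (fun z => Rintegral (q z) setT f)}.
Proof.
move=> cf fc; pose bf : bounded_continuous R X :=
  exist _ f (conj cf (ex_intro _ c fc)).
have ce : continuous (@integral_evaluation R _ X : weak_probability R X -> _).
  exact: initial_continuous.
have cp : continuous ((fun h => h bf) : {ptws bounded_continuous R X -> R} -> R).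
  move=> h U Uh; have /cvg_sup/(_ bf) hh : h --> h by exact: cvg_id.
  apply: hh; exact: (@initial_continuous _ _ (fun k : bounded_continuous R X -> R => k bf) h U Uh).
move=> z; apply: (@continuous_comp _ _ _ (kernel_probability q : subspace D -> _)
  ((fun h => h bf) \o @integral_evaluation R _ X)); first exact: cq.
by apply: continuous_comp; [exact: ce|exact: cp].
Qed.

Local Open Scope ereal_scope.

(** The indicator of an open set is the increasing limit of the continuous
    functions [min 1 (n g)], so [q z U] is a supremum of functions continuous
    on [D]. *)
Lemma lower_semicontinuous_kernel_open (U : set X) : perfectly_normal R X ->
  open U -> lower_semicontinuous ((fun z => q z U) : subspace D -> \bar R).
Proof.
move=> pnX oU z t tqU; have [g [cg g0 Ug]] := pnX _ (open_closedC oU).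
pose f (n : nat) x : R := Num.min 1%R (n%:R * g x)%R.
have cf n : continuous (f n).
  move=> x; apply: (@continuous_min _ _ (cst 1%R) (fun x => n%:R * g x)%R).
    exact: cvg_cst.
  by apply: cvgM; [exact: cvg_cst|exact: cg].
have f0 n x : (0 <= f n x)%R by rewrite le_min ler01 mulr_ge0.
have f1 n x : (f n x <= 1)%R by rewrite ge_min lexx.
have fU n x : (f n x <= \1_U x)%R.
  rewrite indicE; case: (boolP (x \in U)) => xU /=; first exact: f1.
  have : (~` U) x by move/negP: xU; rewrite inE.
  by rewrite Ug /f /= => ->; rewrite mulr0 ge_min lexx orbT.
have mf n : measurable_fun setT (f n).
  apply: measurable_minr => //; apply: measurable_funM => //.
  apply: (measurability _ (RGenOpens.measurableE R)) => _ [_ [a [b ->] <-]].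
  rewrite setTI; apply: borel_open; exact: open_comp.
have mU := borel_open oU.
have nd x : {homo (fun n => (f n x)%:E) : m n / (m <= n)%N >-> m <= n}.
  move=> m n mn; rewrite lee_fin /f le_min ge_min lexx/= ge_min.
  by rewrite [(_ * _ <= _ * _)%R]ler_wpM2r// ?ler_nat// orbT.
have lf x : (fun n => (f n x)%:E) @ \oo --> (\1_U x : R)%:E.
  apply: cvg_EFin; first exact: nearW.
  rewrite indicE; case: (boolP (x \in U)) => xU /=; last first.
    have : (~` U) x by move/negP: xU; rewrite inE.
    rewrite Ug /f /= => ->; rewrite [X in X @ _ --> _](_ : _ = cst 0%R).
      exact: cvg_cst.
    by apply/funext => n /=; rewrite mulr0 min_r.
  have gx : (0 < g x)%R.
    rewrite lt_def g0 andbT; apply/eqP => gx0.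
    by have : (~` U) x; [rewrite Ug|move: xU; rewrite inE].
  apply: cvg_near_cst; near=> n; rewrite /f /=; apply/eqP; rewrite min_l//.
  rewrite -ler_pdivrMr// div1r ltW//.
  by near: n; exact: nbhs_infty_gtr.
have iU z' : \int[q z']_x (\1_U x : R)%:E = q z' U.
  by rewrite integral_indic// setIT.
have : \int[q z]_x (f n x)%:E @[n --> \oo] --> q z U.
  rewrite -iU; have := @cvg_monotone_convergence _ _ R (q z) _ measurableT
    (fun n x => (f n x)%:E) _ _ _.
  move=> H; rewrite (eq_integral (fun x => limn (fun n => (f n x)%:E))).
    by apply: H => // n; [exact/measurable_EFinP|move=> *; rewrite lee_fin].
  by move=> x _; apply/esym/cvg_lim => //; exact: lf.
move=> cvf; have [n tn] : exists n, t%:E < \int[q z]_x (f n x)%:E.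
  apply: contrapT => nex; move: tqU; rewrite ltNge => /negP; apply.
  apply: (cvge_to_le cvf); apply: nearW => n; rewrite leNgt.
  by apply/negP => tn; apply: nex; exists n.
have fin z' : \int[q z']_x (f n x)%:E \is a fin_num.
  rewrite ge0_fin_numE; last by apply: integral_ge0 => x _; rewrite lee_fin.
  apply: (@le_lt_trans _ _ (q z' U)).
    rewrite -iU; apply: ge0_le_integral => //.
    - by move=> *; rewrite lee_fin.
    - exact/measurable_EFinP.
    - exact/measurable_EFinP/measurable_indic.
    - by move=> x _; rewrite lee_fin.
  apply: (@le_lt_trans _ _ 1); last exact: ltry.
  by rewrite -(@prob_kernel _ _ _ _ _ q z') le_measure// inE.
have := @continuous_kernel_integral (f n) 1%R (cf n) _ z.
have f1' x : (`|f n x| <= 1)%R by rewrite ger0_norm.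
move=> /(_ f1') /cvgr_gt /(_ t).
rewrite /Rintegral /= -lte_fin fineK// => /(_ tn) H.
exists [set z' | t < fine (\int[q z']_x (f n x)%:E)]%R; first exact: H.
move=> z' /=; rewrite -lte_fin fineK// => /lt_le_trans; apply.
rewrite -iU; apply: ge0_le_integral => //.
- by move=> *; rewrite lee_fin.
- exact/measurable_EFinP.
- exact/measurable_EFinP/measurable_indic.
- by move=> x _; rewrite lee_fin.
Unshelve. all: by end_near. Qed.

End weak_continuity.

(** * Limits of nearly stationary occupation measures *)

Lemma pushforward_measure (R : realType) d d' (T : measurableType d)
    (U : measurableType d') (nu : {measure set T -> \bar R}) (f : T -> U) :
  measurable_fun setT f ->
  exists l : {measure set U -> \bar R}, forall S, l S = nu (f @^-1` S).
Proof.
move=> mf; unshelve eexists.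
  by unshelve refine (pushforward nu f : {measure set _ -> \bar R}).
by [].
Qed.

(** Serves to dominate measures of sets of pairs that involve finitely many
    actions. *)
Lemma finite_slices_measure (R : realType) dX dA (X : measurableType dX)
    (A : measurableType dA) (nu : {finite_measure set X -> \bar R}) (s : seq A) :
  exists2 l : {measure set (X * A)%type -> \bar R}, (l setT < +oo)%E &
    forall S, l S = (\sum_(a <- s) nu (fun x => S (x, a)))%E.
Proof.
have /choice[l lE] a : exists l : {measure set (X * A)%type -> \bar R},
    forall S, l S = nu ((fun x => (x, a)) @^-1` S).
  by apply: pushforward_measure; exact: pair2_measurable.
pose k n := l (nth point s n).
have kE S : msum k (size s) S = (\sum_(a <- s) nu (fun x => S (x, a)))%E.
  by rewrite /msum (big_nth point) big_mkord; apply: eq_bigr => i _; exact: lE.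
exists (msum k (size s)); last exact: kE.
rewrite [ltLHS]kE; apply: lte_sum_pinfty => a _.
have -> : (fun x => [set: X * A] (x, a)) = [set: X] by apply/seteqP.
by rewrite ltey_eq fin_num_measure.
Qed.

Section limit_occupation.
Context (R : realType) dX dA (X : borelType dX) (A : borelType dA) (d : nat).
Variables (M : mdp R X A d) (Gam : nat -> set (X * A)).
Hypothesis borelX : borel_space R X.
Hypothesis dscA : discrete_space A.
Hypothesis cntA : countable [set: A].
Hypothesis SU : cond_SU M Gam.
Hypothesis condM : cond_M M Gam.
Local Open Scope ereal_scope.

Local Notation Gr := (mdp_graph M).
Local Notation q := (mdp_trans M).

Let pnX : perfectly_normal R X := borel_space_perfectly_normal borelX.

(** The product with its Borel structure: as a product of measurable types it
    carries the product sigma-algebra, which is Borel by [prod_borelE]. *)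
Let XA : borelType _ := HB.pack (X * A)%type
  (Measurable_isBorel.Build _ (X * A)%type (prod_borelE X dscA cntA)).

Let pnXA : perfectly_normal R XA := prod_perfectly_normal dscA pnX.

Lemma compact_graph_closed j : closed (Gam j).
Proof.
have [_ cG _ _] := SU; apply: compact_closed => //.
exact/prod_hausdorff/(borel_space_hausdorff borelX).
Qed.

Let mGam j : measurable (Gam j).
Proof.
rewrite -(setCK (Gam j)); apply: measurableC.
by apply: open_prod_measurable => //; exact/closed_openC/compact_graph_closed.
Qed.

Section ultra.
Variables (G : set_system (probability (X * A)%type R)) (UG : UltraFilter G).
Variable k : 'I_d.+1 -> R.
Hypothesis G_graph : \forall nu \near G, (nu : probability (X * A)%type R) (~` Gr) = 0.
Hypothesis G_invariant : forall B, measurable B -> forall e : R, (0 < e)%R ->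
  \forall nu \near G, (nu : probability (X * A)%type R) (B `*` setT) <=
    \int[nu]_z q z B + e%:E.
Hypothesis G_cost : forall i (e : R), (0 < e)%R ->
  \forall nu \near G, \int[nu : probability (X * A)%type R]_z mdp_cost M i z <= (k i + e)%:E.

Let m : set (X * A) -> R := ulim_measure G.

Let fam : finitely_additive_probability m := ulim_measure_fap UG.

Let mC_le (S : set (X * A)) (c : R) : measurable S ->
  (\forall nu \near G, (nu : probability (X * A)%type R) S <= c%:E) -> (m S <= c)%R.
Proof.
move=> mS Sc; apply: (cvgr_to_le (ulim_measure_cvg UG mS)).
apply: filterS Sc => nu.
by rewrite -[leLHS]fineK ?fin_num_measure// lee_fin.
Qed.

(** Markov's inequality for the cost that tends to infinity off the compact
    sets, uniformly along [G]. *)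
Let m_Gam (e : R) : (0 < e)%R -> exists j, (m (~` Gam j) <= e)%R.
Proof.
move=> e0; have [_ _ _ [i ci]] := SU.
pose C : R := (`|k i| + 1)%R; have C0 : (0 < C)%R by rewrite ltr_wpDl.
move/cvgeyPge : ci => /(_ (C / e)%R)[j _ /(_ j (leqnn _)) /= cj].
exists j; apply: mC_le; first exact: measurableC.
apply: filterS (G_cost i (e := 1) ltr01) => nu nuk.
have L0 : (0 < C / e)%R by rewrite divr_gt0.
have : (C / e)%:E * nu (~` Gam j) <= C%:E.
  apply: (@le_trans _ _ (\int[nu]_z mdp_cost M i z)); last first.
    by apply: le_trans nuk _; rewrite lee_fin lerD2r ler_norm.
  rewrite -integral_cst//; last exact: measurableC.
  apply: (@le_trans _ _ (\int[nu]_(z in ~` Gam j) mdp_cost M i z)).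
    apply: ge0_le_integral => //.
    - exact: measurableC.
    - by move=> *; rewrite lee_fin ltW.
    - by apply: measurable_funTS; exact: mdp_cost_measurable.
    - by move=> z Gz; apply: (le_trans cj); apply: ereal_inf_lbound; exists z.
  apply: ge0_subset_integral => //; first exact: measurableC.
    exact: mdp_cost_measurable.
  by move=> z _; exact: mdp_cost_ge0.
rewrite -[X in _ * X]fineK ?fin_num_measure//; last exact: measurableC.
rewrite -EFinM -[X in _ -> X <= _]fineK ?fin_num_measure//; last exact: measurableC.
rewrite !lee_fin -ler_pdivlMl// => /le_trans; apply.
by rewrite invf_div mulrAC -mulrA mulfV ?gt_eqF// mulr1.
Qed.

Let tight (e : R) : (0 < e)%R ->
  exists K : set XA, [/\ compact K, measurable K & (1 - e <= m K)%R].
Proof.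
move=> /m_Gam[j]; rewrite fapC// => mj; exists (Gam j); split => //.
  by have [_ + _ _] := SU; exact.
by rewrite lerBlDr addrC -lerBlDr.
Qed.

(** Near stationarity bounds the state marginal by the mean of [q z B], to which
    the majorization of the kernel applies. *)
Let marginal_le (O D : set X) (nu : {finite_measure set X -> \bar R}) (B : set X) :
  open O -> closed D ->
  (forall B z, measurable B -> Gr z -> q z ((O `\` D) `&` B) <= nu B) ->
  measurable B -> B `<=` O `\` D -> (m (B `*` setT))%:E <= nu B.
Proof.
move=> oO cD qnu mB BOD; rewrite -[leRHS]fineK ?fin_num_measure// lee_fin.
apply/ler_addgt0Pr => e e0; apply: mC_le; first exact: measurableX.
near=> P; apply: (@le_trans _ _ (\int[P]_z q z B + e%:E)).
  by near: P; exact: G_invariant.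
rewrite EFinD fineK ?fin_num_measure// leeD2r//.
have -> : nu B = \int[P]_z cst (nu B) z.
  by rewrite integral_cst// [X in _ * X]probability_setT mule1.
apply: ae_ge0_le_integral => //.
- exact: measurable_kernel.
- have P0 : P (~` Gr) = 0 by near: P; exact: G_graph.
  exists (~` Gr); split => //.
    by apply: measurableC; exact: mdp_graph_measurable.
  move=> z /= nqz Gz; apply: nqz => _.
  by have := qnu _ _ mB Gz; rewrite (setIidr BOD).
Unshelve. all: by end_near. Qed.

(** A compact set of pairs meets finitely many actions, so up to the mass of
    its complement [m] is a finite sum of slices, each one bounded by the
    marginal of [m] and hence by [nu]. *)
Let dominated (O D : set X) (nu : {finite_measure set X -> \bar R}) :
  open O -> closed D ->
  (forall B z, measurable B -> Gr z -> q z ((O `\` D) `&` B) <= nu B) ->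
  forall e : R, (0 < e)%R ->
    exists2 l : {measure set XA -> \bar R}, l setT < +oo &
    forall S, measurable S -> S `<=` (O `\` D) `*` setT ->
      (m S)%:E <= l S + e%:E.
Proof.
move=> oO cD qnu e e0; have [j mj] := m_Gam e0.
have : finite_set (snd @` Gam j).
  by apply: compact_finite_actions => //; have [_ + _ _] := SU; exact.
move=> /finite_seqP[s sE].
have [l lT lE] := finite_slices_measure nu s; exists l => //.
move=> S mS SOD; rewrite lE.
have mSa a : measurable (fun x => S (x, a)).
  rewrite -[X in measurable X]/((fun x => (x, a)) @^-1` S) -[X in measurable X]setTI.
  exact: pair2_measurable.
have mSX a : measurable ((fun x => S (x, a)) `*` [set: A]) by exact: measurableX.
pose U := \big[setU/set0]_(a <- s) ((fun x => S (x, a)) `*` [set: A]).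
have mU : measurable U by exact: bigsetU_measurable.
have mUle : (m U)%:E <= \sum_(a <- s) nu (fun x => S (x, a)).
  rewrite /U; elim: (s) => [|a t IH]; first by rewrite !big_nil (fap0 fam).
  rewrite !big_cons; apply: (@le_trans _ _ (m ((fun x => S (x, a)) `*` setT) +
    m (\big[setU/set0]_(a <- t) ((fun x => S (x, a)) `*` [set: A])))%:E).
    by rewrite lee_fin (fapUle fam)//; exact: bigsetU_measurable.
  rewrite EFinD leeD//; apply: (marginal_le oO cD qnu) => //.
  by move=> x Sx; have [] := SOD _ Sx.
apply: (@le_trans _ _ (m (U `|` ~` Gam j))%:E).
  rewrite lee_fin (le_fap fam)//; first by apply: measurableU => //; exact: measurableC.
  move=> [x a] Sx; have [Gx|] := pselect (Gam j (x, a)); last by right.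
  left; rewrite /U -bigcup_seq; exists a => //.
  by have : [set` s] a by rewrite -sE; exists (x, a).
apply: (@le_trans _ _ (m U + m (~` Gam j))%:E).
  by rewrite lee_fin (fapUle fam)//; exact: measurableC.
by rewrite EFinD leeD.
Qed.

(** The reverse of the near stationarity inequality, obtained on complements. *)
Let kernel_marginal_le (B : set X) (e : R) : measurable B -> (0 < e)%R ->
  \forall nu \near G, \int[nu : probability (X * A)%type R]_z q z B <=
    (m (B `*` setT) + e)%:E.
Proof.
move=> mB e0; have e2 : (0 < e / 2)%R by rewrite divr_gt0.
have mBX : measurable (B `*` [set: A]) by exact: measurableX.
have mBC : measurable (~` B) by exact: measurableC.
near=> nu.
have H1 : (fine (nu (B `*` setT)) <= m (B `*` setT) + e / 2)%R.
  near: nu; apply: (cvgr_le _ (ulim_measure_cvg UG mBX)).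
  by rewrite ltrDl.
have : nu ((~` B) `*` setT) <= mixture nu q (~` B) + (e / 2)%:E.
  by near: nu; exact: G_invariant.
rewrite -/(mixture nu q B) probability_setC//.
have -> : (~` B) `*` [set: A] = ~` (B `*` [set: A]).
  by rewrite !setXT preimage_setC.
rewrite (probability_setC nu)//.
have : mixture nu q B \is a fin_num by rewrite fin_num_measure.
have : nu (B `*` setT) \is a fin_num by rewrite fin_num_measure.
move: H1; case: (nu (B `*` setT)) => [r1| |]//= H1 _.
by case: (mixture nu q B) => [r2| |]//= _; rewrite !lee_fin => H2; lra.
Unshelve. all: by end_near. Qed.

Let marginal_fap :
  finitely_additive_probability (fun B : set X => m (B `*` [set: A])).
Proof.
split=> [B||B1 B2 m1 m2 B12]; first exact: (fap_ge0 fam).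
- by rewrite setXTT (fap_setT fam).
- rewrite setXT preimage_setU -!setXT; apply: (fapU fam).
  + exact: measurableX.
  + exact: measurableX.
  + by rewrite !setXT -preimage_setI B12 preimage_set0.
Qed.

(** The regularization [mu] of [m] is the limit measure. The auxiliary fact
    [mu_le] is where (M) is used: it compares [mu] with [m] on sets that are
    open relative to every [D * A] on which the model is continuous. It applies
    to superlevel sets of the costs, and of [q(U | .)] for [U] open; the latter
    gives stationarity because the marginal of [mu] and its image by the
    kernel are then both minorants, on open sets, of the marginal of [m]. *)
Lemma ultralimit_occupation : exists mu : probability (X * A)%type R,
  [/\ mu (~` Gr) = 0,
      forall B, measurable B -> mu (B `*` setT) = \int[mu]_z q z B &
      forall i, \int[mu]_z mdp_cost M i z <= (k i)%:E].
Proof.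
have [mu muo] := @finitely_additive_regularization R _ XA m fam pnXA tight.
have mu_le (S : set (X * A)) : measurable S ->
    (forall O D : set X, {within D `*` setT, continuous (kernel_probability q)} ->
      (forall i, lower_semicontinuous
          (mdp_cost M i : subspace (D `*` setT) -> \bar R)) ->
      open (S : set (subspace (D `*` [set: A])))) ->
    (fine (mu S) <= m S)%R.
  move=> mS oS; apply: (@regularization_relatively_open R _ XA m fam mu muo) => //.
  move=> e e0; have [j mj] := m_Gam e0.
  have [V0 [D [nu [[oO KO] cD qnu cq lc]]]] := condM j.
  have /open_subspaceP[V oV VS] := oS V0 D cq lc.
  exists (Gam j), (V0 `*` setT), (D `*` setT), V; split => //.
  - split=> //; split; first exact: compact_graph_closed.
      exact: open_setXT.
    by move=> [x a] Gx; split => //; apply: KO; exists (x, a).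
  - exact: closed_setXT.
  - move=> S' mS' S'OD; apply: (@regularization_dominated R _ XA m fam mu muo pnXA
        ((V0 `\` D) `*` setT)) => //.
    + apply: open_setXT; rewrite setDE; apply: openI => //; exact: closed_openC.
    + exact: (dominated oO cD qnu).
    + move=> z /S'OD[[Oz _] nDz]; split=> //; split=> // Dz; exact: nDz.
exists mu; split.
- apply/eqP; rewrite eq_le measure_ge0 andbT; apply/lee_addgt0Pr => e e0.
  rewrite add0e; have [j mj] := m_Gam e0.
  apply: (@le_trans _ _ (mu (~` Gam j))).
    apply: le_measure; rewrite ?inE.
    + by apply: measurableC; exact: mdp_graph_measurable.
    + exact: measurableC.
    + have [_ _ <- _] := SU; apply: subsetC => z Gz; by exists j.
  have oG : open (~` Gam j) := closed_openC (compact_graph_closed (j := j)).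
  have H : mu (~` Gam j) <= (m (~` Gam j))%:E := muo (~` Gam j) oG.
  by apply: (le_trans H); rewrite lee_fin.
- pose fst_mfun : {mfun (X * A)%type >-> X} :=
    HB.pack (@fst X A) (isMeasurableFun.Build _ _ _ _ (@fst X A) measurable_fst).
  move=> B mB; rewrite setXT.
  apply: (regularization_unique (mu1 := distribution mu fst_mfun)
    (mu2 := mixture mu q) marginal_fap pnX) => // U oU.
    have oUX : open (U `*` [set: A]) by exact: open_setXT.
    by rewrite -[leLHS]/(mu (fst @^-1` U)) -setXT; exact: (muo (U `*` [set: A]) oUX).
  apply: (@integral_le_layers R _ _ G UG mu).
  + exact: measurable_kernel (borel_open oU).
  + by move=> z; exact: measure_ge0.
  + move=> t t0; apply: mu_le.
      rewrite -[X in measurable X]setTI; apply: emeasurable_fun_o_infty => //.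
      exact: measurable_kernel (borel_open oU).
    move=> V0 D cq _; apply: (lower_semicontinuousP _).1.
    exact: lower_semicontinuous_kernel_open.
  + by move=> e e0; apply: kernel_marginal_le => //; exact: borel_open.
- move=> i; apply: (@integral_le_layers R _ _ G UG mu).
  + exact: mdp_cost_measurable.
  + by move=> z; exact: mdp_cost_ge0.
  + move=> t t0; apply: mu_le.
      rewrite -[X in measurable X]setTI; apply: emeasurable_fun_o_infty => //.
      exact: mdp_cost_measurable.
    by move=> O D _ lc; exact: (lower_semicontinuousP _).1 (lc i) t.
  + by move=> e e0; exact: G_cost.
Qed.

End ultra.

End limit_occupation.

(** * Occupation measures and the primal program *)

Section unit_mass.
Context (R : realType) d (T : measurableType d) (g : {measure set T -> \bar R}).
Hypothesis gT : g setT = 1%E.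

Let P (S : set T) : \bar R := g S.

HB.instance Definition _ := Measure.copy P g.

HB.instance Definition _ := Measure_isProbability.Build _ T R P gT.

Lemma measure_to_probability :
  exists P : probability T R, P = g :> (set T -> \bar R).
Proof. by exists P. Qed.

End unit_mass.

Section occupation.
Context (R : realType) dX dA (X : borelType dX) (A : borelType dA) (d : nat).
Variables (M : mdp R X A d).
Local Open Scope ereal_scope.

Local Notation Gr := (mdp_graph M).
Local Notation q := (mdp_trans M).
Local Notation c := (mdp_cost M).
Local Notation PXA := (probability (X * A)%type R).

Definition stationary_occupation (g : PXA) : Prop :=
  g (~` Gr) = 0 /\
  forall B, measurable B -> g (B `*` setT) = \int[g]_z q z B.

Lemma integral_graph (g : {measure set (X * A)%type -> \bar R}) (f : X * A -> \bar R) :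
  g (~` Gr) = 0 -> measurable_fun setT f -> (forall z, 0 <= f z) ->
  \int[g]_(z in Gr) f z = \int[g]_z f z.
Proof.
move=> g0 mf f0; have mG := mdp_graph_measurable M.
have mGC : measurable (~` Gr) by exact: measurableC.
rewrite [RHS](ge0_negligible_integral _ _ _ _ g0)//.
by rewrite setTD setCK.
Qed.

Lemma measurable_weight : measurable_fun setT (weight M).
Proof.
apply: emeasurable_funD => //.
rewrite (_ : (fun z => _) = (fun z => esups (fun n => c (inord n) z) 0%N)).
  by apply: measurable_fun_esups => n; exact: mdp_cost_measurable.
apply/funext => z; rewrite /esups /sdrop; congr ereal_sup.
apply/seteqP; split=> [_ [i _ <-]|_ [n _ <-]]; last by exists (inord n).
by exists i => //=; rewrite inord_val.
Qed.

Lemma cost_le_weight i z : c i z <= weight M z.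
Proof.
by rewrite /weight -[leLHS]add0e leeD//; apply: ereal_sup_ubound; exists i.
Qed.

Lemma weight_le z : weight M z <= 1 + \sum_(i < d.+1) c i z.
Proof.
rewrite leeD2l//; apply: ge_ereal_sup => _ [i _ <-].
rewrite (bigD1 i)//= leeDl//; apply: sume_ge0 => j _; exact: mdp_cost_ge0.
Qed.

(** The slack variables are determined by the costs. The bound [k0] on the
    objective, with the constraints, makes the weight integrable: the weight is
    at most 1 plus the sum of the costs. *)
Lemma primal_of_occupation (g : PXA) (k0 : R) : stationary_occupation g ->
  \int[g]_z c ord0 z <= k0%:E ->
  (forall i, \int[g]_z c (lift ord0 i) z <= (mdp_kappa M i)%:E) ->
  exists2 v, primal_feasible M v & primal_objective M v = \int[g]_z c ord0 z.
Proof.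
move=> [g0 ginv] gk0 gk.
have int_c i : \int[g]_(z in Gr) c i z = \int[g]_z c i z.
  apply: integral_graph => //; first exact: mdp_cost_measurable.
  by move=> z; exact: mdp_cost_ge0.
have c_ge0 i : 0 <= \int[g]_z c i z.
  by apply: integral_ge0 => z _; exact: mdp_cost_ge0.
have c_fin i : \int[g]_z c i z < +oo.
  have [j ->|->] := unliftP ord0 i; last exact: le_lt_trans gk0 (ltry _).
  exact: le_lt_trans (gk j) (ltry _).
pose alpha i := (mdp_kappa M i - fine (\int[g]_z c (lift ord0 i) z))%R.
exists ((g : {finite_measure set _ -> \bar R}), alpha); last exact: int_c.
have mGr := mdp_graph_measurable M.
split => //=.
- split; last first.
    move=> i; rewrite /alpha subr_ge0 -lee_fin fineK//.
    by rewrite ge0_fin_numE.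
  split => //; apply: (@le_lt_trans _ _ (\int[g]_(z in Gr) (1 + \sum_(i < d.+1) c i z))).
    apply: ge0_le_integral => //.
    + by move=> z _; apply: le_trans (cost_le_weight ord0 z); exact: mdp_cost_ge0.
    + by apply: measurable_funTS; exact: measurable_weight.
    + apply: measurable_funTS; apply: emeasurable_funD => //.
      by apply: emeasurable_sum => i; exact: mdp_cost_measurable.
    + by move=> z _; exact: weight_le.
  have mc i : measurable_fun setT (c i) by exact: mdp_cost_measurable.
  rewrite ge0_integralD//; last 2 first.
    + by move=> z _; apply: sume_ge0 => i _; exact: mdp_cost_ge0.
    + by apply: emeasurable_sum => i; exact: measurable_funTS.
  rewrite integral_cst// mul1e ge0_integral_sum//; last 2 first.
    + by move=> i; exact: measurable_funTS.
    + by move=> i z _; exact: mdp_cost_ge0.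
  apply: lte_add_pinfty; first exact: le_lt_trans (probability_le1 g mGr) (ltry _).
  by apply: lte_sum_pinfty => i _; rewrite int_c.
- apply/esym; rewrite -(probability_setT g) -(setUv Gr).
  by rewrite measureU ?setICr//; [rewrite [X in _ + X]g0 adde0|exact: measurableC].
- move=> B mB; rewrite [LHS]ginv//; apply/esym/integral_graph => //.
  exact: measurable_kernel.
- move=> i; rewrite /pairing int_c /alpha EFinB fineK; last by rewrite ge0_fin_numE.
  by rewrite [LHS]addeC; apply: subeK; rewrite ge0_fin_numE.
Qed.

Lemma occupation_of_primal v : primal_feasible M v ->
  exists g : PXA, [/\ stationary_occupation g,
    \int[g]_z c ord0 z = primal_objective M v,
    \int[g]_z c ord0 z < +oo &
    forall i, \int[g]_z c (lift ord0 i) z <= (mdp_kappa M i)%:E].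
Proof.
case: v => g alpha [[[g0 gw] a0] g1 ginv gk]; rewrite /primal_objective/=.
have mGr := mdp_graph_measurable M.
have mc i : measurable_fun setT (c i) by exact: mdp_cost_measurable.
have int_c i : \int[g]_z c i z = pairing M g i.
  by rewrite /pairing integral_graph// => z; exact: mdp_cost_ge0.
have gT : g setT = 1.
  rewrite -(setUv Gr) measureU ?setICr//; last exact: measurableC.
  by rewrite [X in X + _]g1 [X in _ + X]g0 adde0.
have [gP gPE] : exists gP : PXA, gP = g :> (set _ -> \bar R).
  exact: measure_to_probability.
exists gP; rewrite /stationary_occupation gPE.
split; [split => // B mB|exact: int_c| |].
- rewrite [LHS]ginv//; apply: integral_graph => //.
  exact: measurable_kernel.
- rewrite [ltLHS]int_c; apply: le_lt_trans gw; apply: ge0_le_integral => //.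
  + by move=> z _; exact: mdp_cost_ge0.
  + exact: measurable_funTS.
  + by apply: measurable_funTS; exact: measurable_weight.
  + by move=> z _; exact: cost_le_weight.
- move=> i; rewrite [leLHS]int_c -gk leeDl// lee_fin.
  exact: a0.
Qed.

End occupation.

(** * Separation in finite dimension *)

Section separation.
Context (R : realType) (K : finType).
Implicit Types u v p : K -> R.

Lemma norm_sq_segment u p (t : R) :
  \sum_k ((1 - t) * p k + t * u k) ^+ 2 =
  \sum_k p k ^+ 2 + 2 * t * \sum_k p k * (u k - p k)
    + t ^+ 2 * \sum_k (u k - p k) ^+ 2.
Proof.
rewrite !mulr_sumr -!big_split/=; apply: eq_bigr => k _; ring.
Qed.

(** The point [p] of least norm in the closure of [E], found as the ultrafilter
    limit of a minimizing sequence, is the separating functional: minimality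
    along segments issued from [p] reads [J <= <p, u>] on [E], where
    [J = |p| ^ 2]. It is bounded away from 0 since [e] is not in the upward
    closed set [E], and has nonnegative coordinates since [E] is upward
    closed. *)
Lemma separation_upper_convex (E : set (K -> R)) (e : R) : 0 < e ->
  (forall u v t, E u -> E v -> 0 <= t <= 1 ->
    E (fun k => (1 - t) * u k + t * v k)) ->
  (forall u v, E u -> (forall k, u k <= v k) -> E v) ->
  E !=set0 -> ~ E (fun=> e) ->
  exists b : K -> R, (forall k, 0 <= b k) /\
    exists2 c : R, 0 < c & forall u, E u -> c <= \sum_k b k * u k.
Proof.
move=> e0 cvxE upE [u0 Eu0] nEe.
pose N u : R := \sum_k u k ^+ 2.
have N_ge u : E u -> e ^+ 2 <= N u.
  move=> Eu; have [k ku] : exists k, e < u k.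
    apply: contrapT => nex; apply/nEe/(upE u) => // k.
    by rewrite leNgt; apply/negP => ?; apply: nex; exists k.
  rewrite /N (bigD1 k)//= -[leLHS]addr0 lerD//; last first.
    by apply: sumr_ge0 => i _; exact: sqr_ge0.
  by rewrite lerXn2r ?nnegrE ?ltW// (lt_trans e0).
pose J := inf (N @` E).
have hiJ : has_inf (N @` E).
  by split; [exists (N u0), u0|exists (e ^+ 2) => _ [u Eu <-]; exact: N_ge].
have J_ge : e ^+ 2 <= J.
  by apply: lb_le_inf; [exists (N u0), u0|move=> _ [u Eu <-]; exact: N_ge].
have J_le u : E u -> J <= N u.
  by move=> Eu; apply: ge_inf; [have [] := hiJ|exists u].
have /choice[w wP] n : exists u, E u /\ N u < J + harmonic n.
  by have [_ [u Eu <-] uJ] := inf_adherent (harmonic_gt0 n) hiJ; exists u.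
have [U [UU sU]] := ultraFilterLemma (eventually_filter).
have bw k : \forall n \near U, `|w n k| <= J + 2.
  apply: nearW => n; have [_ wn] := wP n.
  have wk : w n k ^+ 2 <= J + 1.
    apply: (@le_trans _ _ (N (w n))); last first.
      apply: (le_trans (ltW wn)); rewrite lerD2l /harmonic/=.
      by rewrite invf_le1 ?ltr0n// ler1n.
    by rewrite /N (bigD1 k)//= lerDl sumr_ge0// => i _; exact: sqr_ge0.
  have J0 : 0 <= J by apply: le_trans J_ge; exact: sqr_ge0.
  rewrite -(@ler_pXn2r _ 2) ?nnegrE// ?addr_ge0//.
  rewrite real_normK ?num_real//; apply: (le_trans wk); nra.
pose p k : R := ulim U (fun n => w n k).
have cvw k : (fun n => w n k) @ U --> p k by exact: ulim_cvg (bw k).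
have Np : N p <= J.
  have cvN : (fun n => N (w n)) @ U --> N p.
    apply: cvg_big => [|k _]; first exact: add_continuous.
    by rewrite expr2; apply: cvgM.
  apply/ler_addgt0Pr => a a0.
  have nearN : \forall n \near \oo, N (w n) <= J + a.
    near=> n; have [_ /ltW/le_trans] := wP n; apply; rewrite lerD2l ltW//.
    by near: n; exact: (cvgr_lt _ (@cvg_harmonic R)).
  exact: (cvgr_to_le cvN (sU _ nearN)).
have Jt u t : E u -> 0 <= t <= 1 -> J <= N (fun k => (1 - t) * p k + t * u k).
  move=> Eu t01.
  have cvN : (fun n => N (fun k => (1 - t) * w n k + t * u k)) @ U -->
      N (fun k => (1 - t) * p k + t * u k).
    apply: cvg_big => [|k _]; first exact: add_continuous.
    rewrite expr2; have H : ((1 - t) * w n k + t * u k) @[n --> U] -->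
        (1 - t) * p k + t * u k.
      by apply: cvgD; [apply: cvgM => //; exact: cvg_cst|exact: cvg_cst].
    exact: cvgM.
  apply: (cvgr_to_ge cvN); apply: nearW => n; apply: J_le.
  by apply: cvxE => //; have [] := wP n.
have J_gt0 : 0 < J by apply: lt_le_trans J_ge; exact: exprn_gt0.
have pu u : E u -> J <= \sum_k p k * u k.
  move=> Eu; have H t : 0 <= t <= 1 -> 0 <= 2 * t * (\sum_k p k * (u k - p k))
      + t ^+ 2 * \sum_k (u k - p k) ^+ 2.
    move=> /(Jt _ _ Eu); rewrite /N norm_sq_segment; move: Np; rewrite /N; lra.
  have s20 : 0 <= \sum_k (u k - p k) ^+ 2 by apply: sumr_ge0 => k _; exact: sqr_ge0.
  have s1E : \sum_k p k * (u k - p k) = \sum_k p k * u k - N p.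
    by rewrite /N -sumrB; apply: eq_bigr => k _; rewrite mulrBr expr2.
  have J_leNp : J <= N p.
    have := Jt _ 0 Eu; rewrite lexx ler01 => /(_ isT).
    by congr (_ <= _); apply: eq_bigr => k _; rewrite subr0 mul1r mul0r addr0.
  suff : 0 <= \sum_k p k * (u k - p k) by rewrite s1E; lra.
  move: (\sum_k p k * (u k - p k)) H => s1 H.
  rewrite leNgt; apply/negP => s10.
  pose s2 := \sum_k (u k - p k) ^+ 2; rewrite -/s2 in H s20.
  (* Small enough for [2 * t * s1 + t ^+ 2 * s2] to be negative; the summand 1
     keeps the denominator positive when [s2 = 0], and [- s1] ensures [t <= 1]. *)
  pose t := - s1 / (s2 + 1 - s1).
  have D0 : 0 < s2 + 1 - s1 by lra.
  have t0 : 0 < t by rewrite divr_gt0// oppr_gt0.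
  have tD : t * (s2 + 1 - s1) = - s1 by rewrite /t divfK// gt_eqF.
  have t1 : t <= 1 by rewrite ler_pdivrMr//; lra.
  have := H t; rewrite (ltW t0) t1 => /(_ isT); nra.
exists p; split; last by exists J.
move=> k; rewrite leNgt; apply/negP => pk0.
have s0 : 0 <= (`|\sum_k p k * u0 k| + 1) / (- p k).
  by rewrite divr_ge0 ?addr_ge0// oppr_ge0 ltW.
move: s0; set s := _ / _ => s0.
(* Raising a coordinate of [u0] where [p] is negative makes [<p, u>] negative;
   [s] is such that its value drops to at most -1. *)
have := pu (fun i => u0 i + (if i == k then s else 0)).
have -> : \sum_i p i * (u0 i + (if i == k then s else 0)) =
    \sum_i p i * u0 i + p k * s.
  under eq_bigr do rewrite mulrDr.
  rewrite big_split/=; congr (_ + _).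
  rewrite (bigD1 k)//= eqxx big1 ?addr0// => i /negbTE ->.
  by rewrite mulr0.
have -> : p k * s = - (`|\sum_k p k * u0 k| + 1).
  by rewrite /s mulrCA invrN mulrN mulfV ?lt_eqF// mulrN1.
move=> /(_ _) H; have : J <= \sum_i p i * u0 i - (`|\sum_k p k * u0 k| + 1).
  apply: H; apply: (upE u0) => // i.
  by case: ifP => _; rewrite ?addr0// lerDl.
by have := ler_norm (\sum_i p i * u0 i); lra.
Unshelve. all: by end_near. Qed.

End separation.

(** * The alternative for finitely many relaxed constraints *)

Section convex_combination.
Context (R : realType) d (T : measurableType d) (g1 g2 : probability T R) (t : R).
Hypothesis t01 : 0 <= t <= 1.
Local Open Scope ereal_scope.

Lemma convex_combination_probability : exists g : probability T R,
  (forall S, g S = (1 - t)%:E * g1 S + t%:E * g2 S) /\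
  forall f, measurable_fun setT f -> (forall z, 0 <= f z) ->
    \int[g]_z f z = (1 - t)%:E * \int[g1]_z f z + t%:E * \int[g2]_z f z.
Proof.
move: t01 => /andP[t0 t1]; have t1' : (0 <= 1 - t)%R by rewrite subr_ge0.
pose m : {measure set T -> \bar R} :=
  measure_add (mscale (NngNum t1') g1) (mscale (NngNum t0) g2).
have mE S : m S = (1 - t)%:E * g1 S + t%:E * g2 S by exact: measure_addE.
have mT : m setT = 1.
  by rewrite mE !probability_setT !mule1 -EFinD subrK.
have [g gE] := measure_to_probability mT.
exists g; rewrite gE; split => // f mf f0.
by rewrite ge0_integral_measure_add// !ge0_integral_mscale.
Qed.

End convex_combination.

Lemma adde_subfine (R : realType) (x : \bar R) (y : R) : x \is a fin_num ->
  (x + (y - fine x)%:E)%E = y%:E.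
Proof. by move=> /fineK <-; rewrite -EFinD subrKC. Qed.

Section duality.
Context (R : realType) dX dA (X : borelType dX) (A : borelType dA) (d : nat).
Variables (M : mdp R X A d).
Local Open Scope ereal_scope.

Local Notation Gr := (mdp_graph M).
Local Notation q := (mdp_trans M).
Local Notation c := (mdp_cost M).
Local Notation PXA := (probability (X * A)%type R).

Definition cost_bound (r : R) (i : 'I_d.+1) : R :=
  if unlift ord0 i is Some j then mdp_kappa M j else r.

(** The constraints of the primal program for the sets [B k] only, relaxed by
    the slacks [u], with the objective turned into a constraint by the bound
    [r]. Stationarity is kept as a one-sided inequality so that the set of
    admissible slacks is upward closed. *)
Definition perturbed_feasible (r : R) (K : Type) (B : K -> set X)
    (u : K + 'I_d.+1 -> R) : set PXA :=
  [set g | [/\ g (~` Gr) = 0,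
    forall k, g (B k `*` setT) <= \int[g]_z q z (B k) + (u (inl k))%:E &
    forall i, \int[g]_z c i z <= (cost_bound r i + u (inr i))%:E]].

Let mc i : measurable_fun setT (c i) := mdp_cost_measurable M i.

Let mGC : measurable (~` Gr) := measurableC (mdp_graph_measurable M).

Let mq B : measurable B -> measurable_fun setT (fun z => q z B).
Proof. by move=> mB; exact: measurable_kernel. Qed.

Let int_q_fin (g : PXA) B : measurable B -> \int[g]_z q z B \is a fin_num.
Proof. by move=> mB; rewrite (fin_num_measure (mixture g q)). Qed.

Let q_fin z B : measurable B -> q z B \is a fin_num.
Proof.
move=> mB; rewrite ge0_fin_numE// (@le_lt_trans _ _ 1) ?ltry//.
by rewrite -(@prob_kernel _ _ _ _ _ q z) le_measure// inE.
Qed.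

Section perturbation.
Variables (r : R) (K : Type) (B : K -> set X).
Hypothesis mB : forall k, measurable (B k).

Lemma perturbed_feasible_convex u v (t : R) (g1 g2 : PXA) : (0 <= t <= 1)%R ->
  perturbed_feasible r B u g1 -> perturbed_feasible r B v g2 ->
  perturbed_feasible r B (fun k => (1 - t) * u k + t * v k)%R !=set0.
Proof.
move=> t01 [g10 g1B g1c] [g20 g2B g2c].
have [g [gE gint]] := convex_combination_probability g1 g2 t01.
move: t01 => /andP[t0 t1]; have t1' : (0 <= 1 - t)%R by rewrite subr_ge0.
exists g; split.
- by rewrite gE g10 g20 !mule0 adde0.
- move=> k; rewrite gE gint//; last exact: mq.
  have := g1B k; have := g2B k.
  have mBX : measurable (B k `*` [set: A]) by exact: measurableX.
  have -> : g1 (B k `*` setT) = (fine (g1 (B k `*` setT)))%:E.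
    by rewrite fineK// fin_num_measure.
  have -> : g2 (B k `*` setT) = (fine (g2 (B k `*` setT)))%:E.
    by rewrite fineK// fin_num_measure.
  rewrite -(fineK (int_q_fin g1 (mB k))) -(fineK (int_q_fin g2 (mB k))).
  rewrite -!EFinM -!EFinD !lee_fin => H2 H1.
  have := ler_wpM2l t0 H2; have := ler_wpM2l t1' H1; lra.
- move=> i; rewrite gint//; last by move=> z; exact: mdp_cost_ge0.
  apply: (le_trans (leeD (lee_wpmul2l _ (g1c i)) (lee_wpmul2l _ (g2c i)))).
  + by rewrite lee_fin.
  + by rewrite lee_fin.
  by rewrite -!EFinM -EFinD lee_fin le_eqVlt; apply/orP; left; apply/eqP; ring.
Qed.

Lemma perturbed_feasible_dirac z : Gr z ->
  perturbed_feasible r B (fun k => match k with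
    | inl j => (\1_(B j) z.1 - fine (q z (B j)))%R
    | inr i => (fine (c i z) - cost_bound r i)%R end) (\d_z : PXA).
Proof.
move=> Gz.
have dE (S : set (X * A)) : (\d_z : PXA) S = (z \in S)%:R%:E by exact: diracE.
have dI f : measurable_fun setT f -> \int[(\d_z : PXA)]_z' f z' = f z.
  by move=> mf; rewrite [LHS]integral_dirac// diracT mul1e.
split=> [|k|i].
- by rewrite dE memNset.
- have dIq : q z (B k) <= \int[(\d_z : PXA)]_z' q z' (B k).
    by rewrite le_eqVlt; apply/orP; left; apply/eqP/esym; apply: dI; exact: mq.
  apply: le_trans (leeD2r _ dIq).
  have -> : q z (B k) + (\1_(B k) z.1 - fine (q z (B k)))%:E = (\1_(B k) z.1)%:E.
    exact: adde_subfine (q_fin _ (mB k)).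
  rewrite [leLHS]dE lee_fin indicE setXT.
  by rewrite (_ : (z \in _) = (z.1 \in B k))//; apply/idP/idP; rewrite !inE.
- rewrite [leLHS]dI// subrKC fineK//.
  by rewrite ge0_fin_numE ?mdp_cost_ge0// mdp_cost_fin.
Qed.

End perturbation.

Lemma integral_kernel_simple (z : X * A) n (B : 'I_n -> set X) (a : 'I_n -> R) :
  (forall k, measurable (B k)) -> (forall k, (0 <= a k)%R) ->
  \int[q z]_y (- \sum_k a k * \1_(B k) y)%:E =
  (- \sum_k a k * fine (q z (B k)))%:E.
Proof.
move=> mB a0; have ge0 k y : (0 <= a k * \1_(B k) y :> R)%R by rewrite mulr_ge0.
under eq_integral do rewrite EFinN -sumEFin.
rewrite integral_ge0N; last by move=> y _; apply: sume_ge0 => k _; rewrite lee_fin.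
rewrite ge0_integral_sum//.
- rewrite EFinN -sumEFin; congr (- _); apply: eq_bigr => k _.
  under eq_integral do rewrite EFinM.
  rewrite ge0_integralZl_EFin//; last exact/measurable_EFinP/measurable_indic.
  by rewrite integral_indic// setIT EFinM fineK// q_fin.
- move=> k; apply/measurable_EFinP; apply: measurable_funM => //.
- by move=> k y _; rewrite lee_fin.
Qed.

(** The slacks [u] for which the perturbed constraints are feasible form a
    convex upward closed set. If it misses the constant slack [e], separation
    gives nonnegative multipliers [b] with [<b, u>] bounded below by a positive
    constant on it. The slack with the single nonzero coordinate
    [<g0, c_0> - r], for a feasible point [g0] of the primal program, shows
    that the multiplier of [c_0] is positive. Normalize it to 1: the slacks of
    the unit masses at admissible pairs turn the separation into the dual
    inequality, with [h] a combination of the indicators of the [B k]. *)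
Lemma finite_alternative (r e : R) n (B : 'I_n -> set X) :
  (forall k, measurable (B k)) -> (0 < e)%R -> primal_consistent M ->
  perturbed_feasible r B (fun=> e) !=set0 \/
  exists2 v, dual_feasible M v & dual_objective M v = r%:E.
Proof.
move=> mB e0 [v0 /occupation_of_primal[g0 [[g00 g0inv] _ g0c0 g0c]]].
have [|nfeas] := pselect (perturbed_feasible r B (fun=> e) !=set0); first by left.
right.
pose E := [set u : 'I_n + 'I_d.+1 -> R | perturbed_feasible r B u !=set0].
have [|||//|b [b0 [a a0 ba]]] := @separation_upper_convex R _ E e e0.
- move=> u v t [g1 Eu] [g2 Ev] t01; exact: (perturbed_feasible_convex mB t01 Eu Ev).
- move=> u v [g [gG gB gc]] uv; exists g; split => // [k|i].
    by apply: (le_trans (gB k)); rewrite leeD2l// lee_fin.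
  by apply: (le_trans (gc i)); rewrite lee_fin lerD2l.
- have [z Gz] : Gr !=set0.
    by have [y Ay] := mdp_adm_nonempty M point; exists (point, y).
  by eexists; exists (\d_z : PXA); exact: (perturbed_feasible_dirac r mB Gz).
pose b_ i := b (inr i).
have b00 : (0 < b_ ord0)%R.
  pose u0 (k : 'I_n + 'I_d.+1) : R := if k == inr ord0 then
    (fine (\int[g0]_z c ord0 z) - r)%R else 0%R.
  have /ba : E u0.
    exists g0; split=> // [k|i]; first by rewrite g0inv// /u0/= adde0.
    rewrite /u0 (inj_eq (@inr_inj _ _)) /cost_bound.
    have [j ->|->] := unliftP ord0 i.
      by rewrite -(inj_eq val_inj)/= addr0.
    rewrite eqxx subrKC fineK// ge0_fin_numE//.
    by apply: integral_ge0 => z _; exact: mdp_cost_ge0.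
  rewrite (bigD1 (inr ord0))//= [X in (_ + X)%R]big1 => [|k /negbTE kn]; last first.
    by rewrite /u0 kn mulr0.
  rewrite addr0 => H; rewrite lt_def b0 andbT; apply/eqP => b00.
  by move: H; rewrite -/(b_ ord0) b00 mul0r leNgt a0.
pose beta j := (- (b_ (lift ord0 j) / b_ ord0))%R.
pose h x : R := (- \sum_(k < n) (b (inl k) / b_ ord0) * \1_(B k) x)%R.
pose rho : R := (r - \sum_(j < d) beta j * mdp_kappa M j)%R.
have w0 k : (0 <= b k / b_ ord0)%R by rewrite divr_ge0// ltW.
exists (rho, h, beta); last by rewrite /dual_objective /rho subrK.
split.
- split.
    apply: measurable_funN; apply: measurable_sum => k.
    by apply: measurable_funM => //; exact: measurable_indic.
  exists (\sum_(k < n) (b (inl k) / b_ ord0))%R => x; rewrite normrN.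
  rewrite (le_trans (ler_norm_sum _ _ _))//; apply: ler_sum => k _.
  rewrite ger0_norm; last by rewrite mulr_ge0.
  by apply: ler_piMr => //; rewrite indicE lern1 leq_b1.
- by move=> i; rewrite oppr_le0; exact: w0.
- move=> z Gz; rewrite integral_kernel_simple//.
  have fc i : c i z = (fine (c i z))%:E.
    by rewrite fineK// ge0_fin_numE ?mdp_cost_ge0// mdp_cost_fin.
  rewrite (eq_bigr (fun i => (beta i * fine (c (lift ord0 i) z))%:E)); last first.
    by move=> i _; rewrite EFinM -fc.
  rewrite sumEFin [leRHS]fc -EFinD lee_fin.
  have /ba := ex_intro _ (\d_z : PXA) (perturbed_feasible_dirac r mB Gz).
  rewrite big_sumType/= big_ord_recl/= {1}/cost_bound unlift_none => H.
  have {H} : (0 <= (\sum_(k < n) b (inl k) * (\1_(B k) z.1 - fine (q z (B k))) +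
     (b_ ord0 * (fine (c ord0 z) - r) +
      \sum_(j < d) b_ (lift ord0 j) * (fine (c (lift ord0 j) z) - mdp_kappa M j))) / b_ ord0)%R.
    rewrite divr_ge0 ?ltW//; apply: (lt_le_trans a0); apply: (le_trans H).
    rewrite lerD2l lerD2l le_eqVlt; apply/orP; left; apply/eqP/eq_bigr => j _.
    by rewrite /cost_bound liftK.
  rewrite !mulrDl [(b_ ord0 * _ / _)%R]mulrAC divff ?gt_eqF// mul1r !mulr_suml.
  rewrite /rho /h.
  have -> : (\sum_(i < d) beta i * mdp_kappa M i =
     - \sum_(i < d) b_ (lift ord0 i) / b_ ord0 * mdp_kappa M i)%R.
    by rewrite -sumrN; apply: eq_bigr => i _; rewrite mulNr.
  have -> : (\sum_(i < d) beta i * fine (c (lift ord0 i) z) =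
     - \sum_(i < d) b_ (lift ord0 i) / b_ ord0 * fine (c (lift ord0 i) z))%R.
    by rewrite -sumrN; apply: eq_bigr => i _; rewrite mulNr.
  have -> : (\sum_(i < n) b (inl i) * (\1_(B i) z.1 - fine (q z (B i))) / b_ ord0 =
     \sum_(i < n) b (inl i) / b_ ord0 * \1_(B i) z.1 -
     \sum_(i < n) b (inl i) / b_ ord0 * fine (q z (B i)))%R.
    by rewrite -sumrB; apply: eq_bigr => i _; rewrite mulrAC mulrBr.
  have -> : (\sum_(i < d) b_ (lift ord0 i) *
       (fine (c (lift ord0 i) z) - mdp_kappa M i) / b_ ord0 =
     \sum_(i < d) b_ (lift ord0 i) / b_ ord0 * fine (c (lift ord0 i) z) -
     \sum_(i < d) b_ (lift ord0 i) / b_ ord0 * mdp_kappa M i)%R.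
    by rewrite -sumrB; apply: eq_bigr => i _; rewrite mulrAC mulrBr.
  lra.
Qed.

End duality.

(** * Attainment and absence of a duality gap *)

Section integral_shift.
Context (R : realType) d (T : measurableType d) (P : {measure set T -> \bar R}).
Hypothesis PT : P setT = 1%E.
Local Open Scope ereal_scope.

Lemma integral_shift (h : T -> R) (C : R) : measurable_fun setT h ->
  (forall x, (`|h x| <= C)%R) ->
  \int[P]_x (h x)%:E \is a fin_num /\
  \int[P]_x (h x)%:E + C%:E = \int[P]_x (h x + C)%:E.
Proof.
move=> mh hC.
have Pfin : P setT < +oo by rewrite PT ltry.
have ih : P.-integrable setT (EFin \o h).
  apply: measurable_bounded_integrable => //.
  by exists C; split; [exact: num_real|move=> N CN x _ /=; exact: le_trans (hC x) (ltW CN)].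
have ic : P.-integrable setT (EFin \o cst C).
  apply: measurable_bounded_integrable => //.
  by exists `|C|%R; split; [exact: num_real|move=> N CN x _ /=; exact: ltW].
split; first exact: integrable_fin_num.
under [RHS]eq_integral do rewrite EFinD.
rewrite [RHS](integralD_EFin measurableT ih ic); congr (_ + _).
by apply/esym; rewrite -[LHS]/(\int[P]_x (cst C%:E x)) integral_cst// PT mule1.
Qed.

End integral_shift.

Section stationary_integral.
Context (R : realType) dX dA (X : borelType dX) (A : borelType dA) (d : nat).
Variables (M : mdp R X A d) (g : probability (X * A)%type R).
Hypothesis gs : stationary_occupation M g.
Local Open Scope ereal_scope.

Lemma stationary_integral (f : X -> \bar R) :
  (forall x, 0 <= f x) -> measurable_fun setT f ->
  \int[g]_z f z.1 = \int[g]_z \int[mdp_trans M z]_x f x.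
Proof.
move=> f0 mf; rewrite -integral_mixture//.
rewrite -[LHS](ge0_integral_pushforward (phi := @fst X A) measurable_fst g
  measurableT mf (fun y _ => f0 y)).
apply: eq_measure_integral => B mB _; have [_ ginv] := gs.
by rewrite -[LHS]/(g (fst @^-1` B)) -setXT ginv.
Qed.

End stationary_integral.

Section attainment.
Context (R : realType) dX dA (X : borelType dX) (A : borelType dA) (d : nat).
Variables (M : mdp R X A d) (Gam : nat -> set (X * A)).
Hypothesis borelX : borel_space R X.
Hypothesis dscA : discrete_space A.
Hypothesis cntA : countable [set: A].
Hypothesis SU : cond_SU M Gam.
Hypothesis condM : cond_M M Gam.
Local Open Scope ereal_scope.

Local Notation Gr := (mdp_graph M).
Local Notation q := (mdp_trans M).
Local Notation c := (mdp_cost M).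
Local Notation PXA := (probability (X * A)%type R).

(** [ultralimit_occupation] along any ultrafilter finer than [F]. *)
Lemma primal_limit (F : set_system PXA) {PF : ProperFilter F} (r : R) :
  (\forall g \near F, (g : PXA) (~` Gr) = 0) ->
  (forall B, measurable B -> forall e : R, (0 < e)%R ->
    \forall g \near F, (g : PXA) (B `*` setT) <= \int[g]_z q z B + e%:E) ->
  (forall i (e : R), (0 < e)%R ->
    \forall g \near F, \int[g : PXA]_z c i z <= (cost_bound M r i + e)%:E) ->
  exists2 v, primal_feasible M v & primal_objective M v <= r%:E.
Proof.
move=> F0 Finv Fc; have [G [UG FG]] := ultraFilterLemma PF.
have [g [g0 ginv gc]] := @ultralimit_occupation R dX dA X A d M Gam borelX dscA
  cntA SU condM G UG (cost_bound M r) (FG _ F0)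
  (fun B mB e e0 => FG _ (Finv B mB e e0)) (fun i e e0 => FG _ (Fc i e e0)).
have gr : \int[g]_z c ord0 z <= r%:E.
  by have := gc ord0; rewrite /cost_bound unlift_none.
have [||v vf vE] := primal_of_occupation (g := g) _ gr; first by split.
  by move=> i; have := gc (lift ord0 i); rewrite /cost_bound liftK.
by exists v => //; rewrite vE.
Qed.

Lemma primal_objective_ge0 v : 0 <= primal_objective M v.
Proof. by apply: integral_ge0 => z _; exact: mdp_cost_ge0. Qed.

Lemma primal_value_ge0 : 0 <= primal_value M.
Proof.
by apply: le_ereal_inf_tmp => _ [v _ <-]; exact: primal_objective_ge0.
Qed.

Lemma primal_consistent_solvable : primal_consistent M -> primal_solvable M.
Proof.
move=> [v0 v0f].
have pfin : primal_value M \is a fin_num.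
  rewrite ge0_fin_numE ?primal_value_ge0//.
  apply: (@le_lt_trans _ _ (primal_objective M v0)).
    by apply: ereal_inf_lbound; exists v0.
  by have [g [_ <- ? _]] := occupation_of_primal v0f.
have /choice[g gP] n : exists g : PXA, [/\ stationary_occupation M g,
    \int[g]_z c ord0 z < primal_value M + (harmonic n)%:E &
    forall i, \int[g]_z c (lift ord0 i) z <= (mdp_kappa M i)%:E].
  have [_ [v vf <-] vlt] := lb_ereal_inf_adherent (harmonic_gt0 n : (0 < harmonic n :> R)%R) pfin.
  by have [g [gs gv _ gk]] := occupation_of_primal vf; exists g; rewrite gv.
have [|||v vf vle] := @primal_limit (g @ \oo) _ (fine (primal_value M)).
- suff : \forall n \near \oo, g n (~` Gr) = 0 by [].
  by apply: nearW => n; have [[]] := gP n.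
- move=> B mB e e0.
  suff : \forall n \near \oo, g n (B `*` setT) <= \int[g n]_z q z B + e%:E by [].
  apply: nearW => n; have [[_ ginv] _ _] := gP n.
  by rewrite ginv// leeDl// lee_fin ltW.
- move=> i e e0; suff : \forall n \near \oo, \int[g n]_z c i z <=
    (cost_bound M (fine (primal_value M)) i + e)%:E by [].
  near=> n; have [_ gn gk] := gP n.
  rewrite /cost_bound; have [j ->|->] := unliftP ord0 i.
    by apply: (le_trans (gk j)); rewrite lee_fin lerDl ltW.
  apply: (le_trans (ltW gn)); rewrite EFinD fineK// leeD2l// lee_fin ltW//.
  by near: n; exact: (cvgr_lt _ (@cvg_harmonic R)).
exists v => //; apply/eqP; rewrite eq_le; apply/andP; split.
  by rewrite (le_trans vle)// fineK.
by apply: ereal_inf_lbound; exists v.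
Unshelve. all: by end_near. Qed.

Lemma dual_zero_feasible : dual_feasible M (0%R, cst 0%R, cst 0%R).
Proof.
split => //; first by split => //; exists 0%R => x; rewrite normr0.
move=> z _; rewrite integral0 sube0 adde0 big1 ?adde0//.
  exact: mdp_cost_ge0.
by move=> i _; rewrite mul0e.
Qed.

(** For finitely many sets and a tolerance, [finite_alternative] yields
    approximate solutions, since its other branch is a dual point of value
    [r], above the supremum. These sets of approximate solutions decrease when
    sets are added or the tolerance decreases: they generate a filter, and
    every limit of it satisfies all the constraints exactly. *)
Lemma primal_value_le_of_dual (r : R) : primal_consistent M ->
  dual_value M < r%:E -> primal_value M <= r%:E.
Proof.
move=> cons dr.
pose D := [set p : seq (set X) * nat | forall B, B \in p.1 -> measurable B].
pose B_ (s : seq (set X)) (k : 'I_(size s)) := nth set0 s k.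
pose N (p : seq (set X) * nat) : set PXA :=
  perturbed_feasible M r (B_ p.1) (fun=> harmonic p.2).
have mem_B (s : seq (set X)) B : B \in s -> exists k, B = B_ s k.
  by move=> Bs; rewrite -index_mem in Bs; exists (Ordinal Bs); rewrite /B_/= nth_index// -index_mem.
have N_sub s1 s2 n1 n2 : {subset s1 <= s2} -> (n1 <= n2)%N -> N (s2, n2) `<=` N (s1, n1).
  move=> s12 n12 g [g0 gB gc].
  have h12 : (harmonic n2 <= harmonic n1 :> R)%R.
    by rewrite lef_pV2 ?posrE ?ltr0n// ler_nat.
  split => // [k|i].
    have /s12/mem_B[l ->] : B_ s1 k \in s1 by exact: mem_nth.
    by apply: (le_trans (gB l)); rewrite leeD2l// lee_fin.
  by apply: (le_trans (gc i)); rewrite lee_fin lerD2l.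
have FF : Filter (filter_from D N).
  apply: filter_from_filter; first by exists ([::], 0%N).
  move=> [s1 n1] [s2 n2] D1 D2; exists (s1 ++ s2, maxn n1 n2).
    by move=> B /=; rewrite mem_cat => /orP[/D1|/D2].
  move=> g Ng; split; apply: N_sub Ng; rewrite ?leq_maxl ?leq_maxr//.
    by move=> B; rewrite mem_cat => ->.
  by move=> B; rewrite mem_cat => ->; rewrite orbT.
have PF : ProperFilter (filter_from D N).
  apply: filter_from_proper => -[s n] Ds.
  have [k||//|[v vf vr]] := @finite_alternative R dX dA X A d M r (harmonic n) _ (B_ s) _ _ cons.
  - by apply: Ds; exact: mem_nth.
  - exact: harmonic_gt0.
  - by move: dr; rewrite ltNge -vr ereal_sup_ubound//; exists v.
have [|||v vf vr] := @primal_limit (filter_from D N) PF r.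
- by exists ([::], 0%N) => // g [].
- move=> B mB e e0; have [n _ /(_ n (leqnn _)) ne] := cvgr_lt _ (@cvg_harmonic R) _ e0.
  exists ([:: B], n).
    by move=> B' /=; rewrite inE => /eqP ->.
  move=> g [_ gB _]; have := gB (Ordinal (ltn0Sn 0)).
  by move=> /le_trans; apply; rewrite leeD2l// lee_fin ltW.
- move=> i e e0; have [n _ /(_ n (leqnn _)) ne] := cvgr_lt _ (@cvg_harmonic R) _ e0.
  exists ([::], n) => // g [_ _ /(_ i)] /le_trans; apply.
  by rewrite lee_fin lerD2l ltW.
by apply: le_trans vr; apply: ereal_inf_lbound; exists v.
Qed.

Lemma primal_le_dual : primal_consistent M -> primal_value M <= dual_value M.
Proof.
move=> cons; have d0 : 0 <= dual_value M.
  apply: ereal_sup_ubound; exists (0%R, cst 0%R, cst 0%R).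
    exact: dual_zero_feasible.
  by rewrite /= big1 ?addr0// => i _; rewrite mul0r.
have [->|] := eqVneq (dual_value M) +oo; first by rewrite leey.
rewrite -ltey -ge0_fin_numE// => dfin.
apply/lee_addgt0Pr => e e0; rewrite -(fineK dfin) -EFinD.
by apply: primal_value_le_of_dual => //; rewrite -[ltLHS](fineK dfin) lte_fin ltrDl.
Qed.

(** Integrate the dual constraint against a stationary measure: the terms in
    [h] cancel. To stay with nonnegative integrands, [h] is shifted by a bound
    [C] and [`|rho|] is added to both sides. *)
Lemma dual_le_primal : dual_value M <= primal_value M.
Proof.
apply: ge_ereal_sup => _ [[[rho h] beta] [[mh [C hC]] b0 dz] <-].
apply: le_ereal_inf_tmp => _ [v /occupation_of_primal[g [gs <- gc0 gc]] <-].
have [g0 _] := gs.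
have C0 : (0 <= C)%R by apply: le_trans (hC point); exact: normr_ge0.
pose h' x : R := (h x + C)%R.
have h'0 x : (0 <= h' x)%R by have := hC x; rewrite ler_norml /h'; lra.
have mh' : measurable_fun setT (fun x => (h' x)%:E).
  by apply/measurable_EFinP; exact: measurable_funD.
have shift z : exists2 t : R, (0 <= t)%R & \int[q z]_y (h' y)%:E = t%:E /\
    \int[q z]_y (h y)%:E = (t - C)%:E.
  have [hfin hE] := integral_shift (@prob_kernel _ _ _ _ _ q z) mh hC.
  exists (fine (\int[q z]_y (h y)%:E) + C)%R.
    rewrite -lee_fin EFinD fineK// hE; apply: integral_ge0 => y _.
    by rewrite lee_fin; exact: h'0.
  by rewrite EFinD fineK// hE addrK fineK.
have mc i : measurable_fun setT (c i) := mdp_cost_measurable M i.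
have c_ge0 i z : 0 <= c i z by exact: mdp_cost_ge0.
have nb0 i : (0 <= - beta i)%R by rewrite oppr_ge0.
have mhq : measurable_fun setT (fun z => \int[q z]_y (h' y)%:E).
  by apply: measurable_integral_kernel => // x; rewrite lee_fin.
have mhx : measurable_fun setT (fun z : X * A => (h' z.1)%:E).
  exact: measurableT_comp mh' measurable_fst.
have mbc i : measurable_fun setT (fun z => (- beta i)%:E * c (lift ord0 i) z).
  exact: measurable_funeM.
have sbc_ge0 z : 0 <= \sum_(i < d) (- beta i)%:E * c (lift ord0 i) z.
  by apply: sume_ge0 => i _; apply: mule_ge0 => //; rewrite lee_fin.
have msbc : measurable_fun setT (fun z => \sum_(i < d) (- beta i)%:E * c (lift ord0 i) z).
  exact: emeasurable_sum.
have hq_ge0 z : 0 <= \int[q z]_y (h' y)%:E.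
  by apply: integral_ge0 => y _; rewrite lee_fin.
have h'E0 x : 0 <= (h' x)%:E by rewrite lee_fin.
have nr0 : (0 <= `|rho| + rho)%R by have := ler_norm (- rho); rewrite normrN; lra.
have ineq z : Gr z -> (`|rho| + rho)%:E + (h' z.1)%:E <=
    (`|rho|%:E + c ord0 z) +
    (\sum_(i < d) (- beta i)%:E * c (lift ord0 i) z + \int[q z]_y (h' y)%:E).
  move=> Gz; have := dz z Gz; have [t t0 [-> ->]] := shift z.
  have fc i : c i z = (fine (c i z))%:E.
    by rewrite fineK// ge0_fin_numE ?mdp_cost_ge0// mdp_cost_fin.
  rewrite (eq_bigr (fun i => (beta i * fine (c (lift ord0 i) z))%:E)); last first.
    by move=> i _; rewrite EFinM -fc.
  rewrite [X in _ -> _ <= _ + (X + _)](eq_bigr (fun i =>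
    (- beta i * fine (c (lift ord0 i) z))%:E)); last first.
    by move=> i _; rewrite EFinM -fc.
  rewrite !sumEFin (fc ord0) -!EFinD !lee_fin /h'.
  under [X in _ -> (_ <= _ + (X + _))%R]eq_bigr do rewrite mulNr.
  rewrite sumrN; lra.
have cfin i : \int[g]_z c i z \is a fin_num.
  rewrite ge0_fin_numE; last exact: integral_ge0.
  by have [j ->|->] := unliftP ord0 i => //; exact: le_lt_trans (gc j) (ltry _).
have Ih : \int[g]_z (h' z.1)%:E = \int[g]_z \int[q z]_y (h' y)%:E.
  exact: (stationary_integral gs h'E0 mh').
have int1 (r : R) : \int[g]_z cst r%:E z = r%:E.
  rewrite integral_cst//; transitivity (r%:E * 1); last by rewrite mule1.
  congr (_ * _); apply: (probability_setT g).
have Ihfin : \int[g]_z (h' z.1)%:E \is a fin_num.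
  rewrite ge0_fin_numE; last exact: integral_ge0.
  apply: (@le_lt_trans _ _ (\int[g]_z cst (2 * C)%:E z)).
    apply: ge0_le_integral => // z _; rewrite lee_fin /h'.
    by have := hC z.1; rewrite ler_norml; lra.
  by rewrite int1 ltry.
have H : \int[g]_z ((`|rho| + rho)%:E + (h' z.1)%:E) <=
    \int[g]_z ((`|rho|%:E + c ord0 z) +
    (\sum_(i < d) (- beta i)%:E * c (lift ord0 i) z + \int[q z]_y (h' y)%:E)).
  apply: ae_ge0_le_integral => //.
  - by move=> z _; rewrite adde_ge0// lee_fin.
  - exact: emeasurable_funD.
  - by move=> z _; apply: adde_ge0; apply: adde_ge0 => //; rewrite lee_fin.
  - by apply: emeasurable_funD; exact: emeasurable_funD.
  - exists (~` Gr); split => //.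
      by apply: measurableC; exact: mdp_graph_measurable.
    by move=> z /= nz Gz; apply: nz => _; exact: ineq.
move: H; rewrite ge0_integralD//.
rewrite ge0_integralD//; [|by move=> z _; apply: adde_ge0 => //; rewrite lee_fin
  |exact: emeasurable_funD|by move=> z _; apply: adde_ge0|exact: emeasurable_funD].
rewrite ge0_integralD// ge0_integralD// -Ih !int1 ge0_integral_sum//; last first.
  by move=> i z _; rewrite mule_ge0// lee_fin.
under eq_bigr do rewrite ge0_integralZl_EFin//.
rewrite -(fineK Ihfin) -(fineK (cfin ord0)).
rewrite (eq_bigr (fun i => (- beta i * fine (\int[g]_z c (lift ord0 i) z))%:E)); last first.
  by move=> i _; rewrite EFinM fineK.
rewrite sumEFin -!EFinD !lee_fin /dual_objective.
have : (\sum_(i < d) beta i * mdp_kappa M i <=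
    - \sum_(i < d) - beta i * fine (\int[g]_z c (lift ord0 i) z))%R.
  rewrite -sumrN; apply: ler_sum => i _; rewrite mulNr opprK ler_wnM2l//.
  by rewrite -lee_fin fineK.
lra.
Qed.

End attainment.

(** * Laws of state-action pairs under a policy *)

Lemma integral_indicT (R : realType) d (T : measurableType d)
    (m : {measure set T -> \bar R}) (S : set T) : measurable S ->
  (\int[m]_x (\1_S x)%:E = m S)%E.
Proof. by move=> mS; rewrite integral_indic// setIT. Qed.

Section trajectory.
Context (R : realType) dX dA (X : borelType dX) (A : borelType dA).
Local Notation history n := (n.-tuple (X * A) * X)%type.
Variables (mu : forall n, R.-pker (history n) ~> A) (q : R.-pker (X * A) ~> X).
Variable zeta : probability X R.
Local Open Scope ereal_scope.

Local Notation P := (history_law mu q zeta).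

Let current_pair n (ha : history n * A) : X * A := (ha.1.2, ha.2).

Let measurable_current_pair n : measurable_fun setT (@current_pair n).
Proof.
apply/measurable_fun_pair => //=.
exact: (measurableT_comp measurable_snd measurable_fst).
Qed.

Definition state_action_kernel n : history n -> {measure set (X * A) -> \bar R} :=
  mkcomp (mu n) (kdirac (@measurable_current_pair n)).

HB.instance Definition _ n := isKernel.Build _ _ _ _ R (@state_action_kernel n)
  (measurable_fun_mkcomp_sfinite (mu n) (kdirac (@measurable_current_pair n))).

Lemma state_action_kernelE n h S : measurable S ->
  state_action_kernel (h : history n) S = mu n h [set a | S (h.2, a)].
Proof.
move=> mS; rewrite -[LHS]/(kcomp (mu n) (kdirac (@measurable_current_pair n)) h S).
rewrite /kcomp /kdirac /=.
have mSh : measurable [set a | S (h.2, a)].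
  by rewrite -[X in measurable X]setTI; exact: pair1_measurable.
by rewrite -[RHS]integral_indicT.
Qed.

Let state_action_kernelT n h : @state_action_kernel n h setT = 1.
Proof. by rewrite state_action_kernelE//; exact: prob_kernel. Qed.

HB.instance Definition _ n := Kernel_isProbability.Build _ _ _ _ R
  (@state_action_kernel n) (@state_action_kernelT n).

Lemma integral_state_action_kernel n h (f : X * A -> \bar R) :
  (forall z, 0 <= f z) -> measurable_fun setT f ->
  \int[state_action_kernel (h : history n)]_z f z = \int[mu n h]_a f (h.2, a).
Proof.
move=> f0 mf.
rewrite [LHS](@integral_kcomp _ _ _ _ _ _ R (mu n) (kdirac (@measurable_current_pair n)) h f f0 mf).
apply: eq_integral => a _.
by rewrite [LHS]integral_dirac// diracT mul1e.
Qed.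

Definition state_action_law n : probability (X * A)%type R :=
  mixture (P n) (@state_action_kernel n).

Definition state_law n (B : set X) : \bar R := P n [set h | B h.2].

Lemma state_law_succ n B : measurable B ->
  state_law n.+1 B = \int[state_action_law n]_z q z B.
Proof.
move=> mB; rewrite integral_mixture//; last exact: measurable_kernel.
apply: eq_integral => h _; rewrite integral_state_action_kernel//.
exact: measurable_kernel.
Qed.

Lemma state_action_law_marginal n B : measurable B ->
  state_action_law n (B `*` setT) = state_law n B.
Proof.
move=> mB; rewrite /state_law -[LHS]/(\int[P n]_h state_action_kernel h (B `*` setT)).
have mBh : measurable [set h : history n | B h.2].
  by rewrite -[X in measurable X]setTI; exact: measurable_snd.
rewrite -[RHS]integral_indicT//; apply: eq_integral => h _.
rewrite state_action_kernelE ?indicE; last exact: measurableX.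
have [Bh|Bh] := boolP (h \in _).
  rewrite (_ : [set a | _] = setT) ?prob_kernel//; apply/seteqP; split=> a //= _.
  by move: Bh; rewrite inE.
rewrite (_ : [set a | _] = set0) ?measure0//; apply/seteqP; split=> a //= [Bh2 _].
by move/negP : Bh; rewrite inE.
Qed.

Lemma measurable_tnth_history n (k : 'I_n) :
  measurable_fun setT (fun h : history n => tnth h.1 k).
Proof. exact: (measurableT_comp (measurable_tnth k) measurable_fst). Qed.

(** The law of the pair at time [k] does not depend on the length of the
    history in which it is read: later steps are probability kernels. *)
Lemma history_law_pair n (k : 'I_n) S : measurable S ->
  P n [set h | S (tnth h.1 k)] = state_action_law k S.
Proof.
elim: n k => [|n IH] k mS; first by case: k.
have [kn|kn] := ltnP k n.
  rewrite -(IH (Ordinal kn) mS).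
  have mSh : measurable [set h : history n | S (tnth h.1 (Ordinal kn))].
    by rewrite -[X in measurable X]setTI; exact: measurable_tnth_history.
  rewrite -[RHS]integral_indicT//; apply: eq_integral => h _.
  have E a y : tnth (history_next h (a, y)).1 k = tnth h.1 (Ordinal kn).
    rewrite (tnth_nth (h.2, a)) [RHS](tnth_nth (h.2, a))/= nth_rcons.
    by rewrite size_tuple kn.
  rewrite /history_step indicE.
  have [Sh|Sh] := boolP (h \in _).
    rewrite (eq_integral (cst 1)) => [|a _].
      by rewrite integral_cst// mul1e; exact: prob_kernel.
    rewrite (_ : mkset _ = setT) ?prob_kernel//; apply/seteqP; split=> y //= _.
    by rewrite (E a y); move: Sh; rewrite inE.
  apply: integral0_eq => a _.
  rewrite (_ : mkset _ = set0) ?measure0//; apply/seteqP; split=> y //=.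
  by rewrite (E a y) => Sh2; move/negP : Sh; rewrite inE.
have -> : k = ord_max by apply/val_inj/eqP; rewrite eqn_leq kn -ltnS ltn_ord.
apply: eq_integral => h _; rewrite state_action_kernelE//.
have mSh : measurable [set a | S (h.2, a)].
  by rewrite -[X in measurable X]setTI; exact: pair1_measurable.
rewrite -[RHS]integral_indicT//; apply: eq_integral => a _.
have E y : tnth (history_next h (a, y)).1 ord_max = (h.2, a).
  by rewrite (tnth_nth (h.2, a))/= nth_rcons size_tuple ltnn eqxx.
rewrite indicE; have [Sh|Sh] := boolP (a \in _).
  rewrite (_ : mkset _ = setT) ?prob_kernel//; apply/seteqP; split=> y //= _.
  by rewrite (E y); move: Sh; rewrite inE.
rewrite (_ : mkset _ = set0) ?measure0//; apply/seteqP; split=> y //=.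
by rewrite (E y) => Sh2; move/negP : Sh; rewrite inE.
Qed.

Lemma integral_history_pair n (k : 'I_n) (f : X * A -> \bar R) :
  (forall z, 0 <= f z) -> measurable_fun setT f ->
  \int[P n]_h f (tnth h.1 k) = \int[state_action_law k]_z f z.
Proof.
move=> f0 mf.
transitivity (\int[pushforward (P n) (fun h => tnth h.1 k)]_z f z).
  by rewrite ge0_integral_pushforward//; exact: measurable_tnth_history.
apply: eq_measure_integral => [|mt S mS _]; first exact: measurable_tnth_history.
exact: history_law_pair.
Qed.

End trajectory.

(** * From policies to the primal program *)

Lemma measureC_eq0 (R : realType) d (T : measurableType d)
    (m : {measure set T -> \bar R}) (S : set T) : measurable S ->
  m setT = 1%E -> m S = 1%E -> m (~` S) = 0%E.
Proof.
move=> mS mT mS1; have [P PE] := measure_to_probability mT.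
by rewrite -PE probability_setC// PE mS1 subee.
Qed.

Lemma limn_esup_le_near (R : realType) (u : (\bar R)^nat) (b e : R) :
  (limn_esup u <= b%:E)%E -> 0 < e -> \forall n \near \oo, (u n <= (b + e)%:E)%E.
Proof.
move=> ub e0; have : (ereal_inf (range (esups u)) < (b + e)%:E)%E.
  rewrite -(cvg_lim _ (@cvg_esups_inf _ u))// -limn_esup_lim.
  by rewrite (le_lt_trans ub)// lte_fin ltrDl.
move=> /ereal_inf_lt[_ [N _ <-]] uN; exists N => // n /= Nn.
by apply: le_trans (ltW uN); apply: ereal_sup_ubound; exists n.
Qed.

Lemma average_probability (R : realType) d (T : measurableType d)
    (P : nat -> probability T R) (n : nat) :
  exists g : probability T R,
  (forall S, g S = (n.+1%:R^-1)%:E * \sum_(k < n.+1) P k S)%E /\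
  forall f, measurable_fun setT f -> (forall z, (0 <= f z)%E) ->
    (\int[g]_z f z = (n.+1%:R^-1)%:E * \sum_(k < n.+1) \int[P k]_z f z)%E.
Proof.
have n0 : 0 <= n.+1%:R^-1 :> R by rewrite invr_ge0.
pose m : {measure set T -> \bar R} := mscale (NngNum n0) (msum P n.+1).
have mE S : m S = ((n.+1%:R^-1)%:E * \sum_(k < n.+1) P k S)%E by [].
have mT : m setT = 1%E.
  rewrite mE (eq_bigr (fun=> 1%E)) => [|k _]; last exact: probability_setT.
  by rewrite sumEFin -EFinM sumr_const card_ord mulVf ?pnatr_eq0.
have [g gE] := measure_to_probability mT.
exists g; rewrite gE; split => // f mf f0.
by rewrite ge0_integral_mscale// ge0_integral_measure_sum.
Qed.

Section policy_occupation.
Context (R : realType) dX dA (X : borelType dX) (A : borelType dA) (d : nat).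
Variables (M : mdp R X A d).
Hypothesis dscA : discrete_space A.
Variables (pi : policy M) (zeta : probability X R).
Local Open Scope ereal_scope.

Local Notation Gr := (mdp_graph M).
Local Notation q := (mdp_trans M).
Local Notation c := (mdp_cost M).
Local Notation gamma := (state_action_law (policy_ker pi) q zeta).

Lemma state_action_law_graph n : gamma n (~` Gr) = 0.
Proof.
apply: integral0_eq => h _; rewrite state_action_kernelE; last first.
  by apply: measurableC; exact: mdp_graph_measurable.
have mA S : measurable (S : set A) by exact: measurable_discrete.
apply: (measureC_eq0 (S := mdp_adm M h.2)) => //; first exact: prob_kernel.
exact: policy_adm.
Qed.

Lemma expected_costE i n :
  expected_cost pi zeta i n = \sum_(k < n) \int[gamma k]_z c i z.
Proof.
have mc : measurable_fun setT (c i) by exact: mdp_cost_measurable.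
have c0 z : 0 <= c i z by exact: mdp_cost_ge0.
rewrite /expected_cost ge0_integral_sum//.
- by apply: eq_bigr => k _; rewrite integral_history_pair.
- by move=> k; exact: measurableT_comp mc (measurable_tnth_history k).
Qed.

(** The averaged law of the first [n + 1] pairs. Its marginal and its image by
    the kernel are averages of the state laws at the times 0 to [n] and 1 to
    [n + 1], which differ by at most [1 / (n + 1)]. *)
Lemma policy_occupation n : exists g : probability (X * A)%type R,
  [/\ g (~` Gr) = 0,
    forall B, measurable B ->
      g (B `*` setT) <= \int[g]_z q z B + (n.+1%:R^-1)%:E &
    forall i, \int[g]_z c i z = (n.+1%:R^-1)%:E * expected_cost pi zeta i n.+1].
Proof.
have [g [gE gint]] := average_probability gamma n; exists g; split.
- by rewrite gE big1 ?mule0// => k _; exact: state_action_law_graph.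
- move=> B mB; have n0 : (0 <= n.+1%:R^-1 :> R)%R by rewrite invr_ge0.
  rewrite gE gint//; last exact: measurable_kernel.
  rewrite -[X in _ <= _ + X]mule1 -ge0_muleDr//; last first.
    by apply: sume_ge0 => k _; apply: integral_ge0.
  apply: lee_wpmul2l; first by rewrite lee_fin.
  rewrite (eq_bigr (fun k : 'I_n.+1 => state_law (policy_ker pi) q zeta k B)); last first.
    by move=> k _; exact: state_action_law_marginal.
  rewrite [X in _ <= X + _](eq_bigr (fun k : 'I_n.+1 => state_law (policy_ker pi) q zeta k.+1 B)); last first.
    by move=> k _; rewrite state_law_succ.
  rewrite big_ord_recl [X in _ <= X + _]big_ord_recr/= addeC.
  have mBh : measurable [set h : (0.-tuple (X * A) * X)%type | B h.2].
    by rewrite -[X in measurable X]setTI; exact: measurable_snd.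
  apply: leeD; last exact: probability_le1.
  by rewrite leeDl//; exact: measure_ge0.
- move=> i; rewrite expected_costE gint//; last by move=> z; exact: mdp_cost_ge0.
  exact: mdp_cost_measurable.
Qed.

End policy_occupation.

Section policy_to_primal.
Context (R : realType) dX dA (X : borelType dX) (A : borelType dA) (d : nat).
Variables (M : mdp R X A d) (Gam : nat -> set (X * A)).
Hypothesis borelX : borel_space R X.
Hypothesis dscA : discrete_space A.
Hypothesis cntA : countable [set: A].
Hypothesis SU : cond_SU M Gam.
Hypothesis condM : cond_M M Gam.
Local Open Scope ereal_scope.

(** The averaged occupation measures are nearly stationary, and their costs are
    the quotients whose upper limits are the average costs. *)
Lemma policy_primal (p : policy M * probability X R) : feasible_pairs p ->
  exists2 v, primal_feasible M v & primal_objective M v <= average_cost p.1 p.2 ord0.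
Proof.
move=> [J0fin Jk]; case: p J0fin Jk => pi zeta /= J0fin Jk.
have ec_ge0 i n : 0 <= (n%:R^-1)%:E * expected_cost pi zeta i n.
  rewrite mule_ge0// ?lee_fin ?invr_ge0//.
  by apply: integral_ge0 => h _; apply: sume_ge0 => k _; exact: mdp_cost_ge0.
have J0 : average_cost pi zeta ord0 \is a fin_num.
  rewrite ge0_fin_numE// /average_cost limn_esup_lim.
  apply: lime_ge; first exact: is_cvg_esups.
  apply: nearW => n; apply: le_trans (ec_ge0 ord0 n) _.
  by apply: ereal_sup_ubound; exists n => /=.
have /choice[g gP] n := policy_occupation dscA pi zeta n.
rewrite -(fineK J0).
apply: (@primal_limit R dX dA X A d M Gam borelX dscA cntA SU condM (g @ \oo) _).
- suff : \forall n \near \oo, g n (~` mdp_graph M) = 0 by [].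
  by apply: nearW => n; have [] := gP n.
- move=> B mB e e0.
  suff : \forall n \near \oo, g n (B `*` setT) <=
    \int[g n]_z mdp_trans M z B + e%:E by [].
  near=> n; have [_ gB _] := gP n; apply: (le_trans (gB _ mB)).
  rewrite leeD2l// lee_fin ltW//.
  by near: n; exact: (cvgr_lt _ (@cvg_harmonic R)).
- move=> i e e0; suff : \forall n \near \oo, \int[g n]_z mdp_cost M i z <=
    (cost_bound M (fine (average_cost pi zeta ord0)) i + e)%:E by [].
  have [N _ HN] : \forall n \near \oo, (n%:R^-1)%:E * expected_cost pi zeta i n <=
      (cost_bound M (fine (average_cost pi zeta ord0)) i + e)%:E.
    apply: limn_esup_le_near => //; rewrite /cost_bound.
    have [j ->|->] := unliftP ord0 i; first exact: Jk.
    by rewrite fineK.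
  exists N => // n Nn; have [_ _ ->] := gP n; apply: HN; exact: leqW.
Unshelve. all: by end_near. Qed.

End policy_to_primal.

(** * Disintegration over a countable action space *)

Section finite_mass.
Context (R : realType) d (T : measurableType d) (g : {measure set T -> \bar R}).
Hypothesis gT : (g setT < +oo)%E.

Let P (S : set T) : \bar R := g S.

HB.instance Definition _ := Measure.copy P g.

Let finP : fin_num_fun P.
Proof. exact: lty_fin_num_fun. Qed.

HB.instance Definition _ := Measure_isFinite.Build _ T R P finP.

Lemma measure_to_finite :
  exists P : {finite_measure set T -> \bar R}, P = g :> (set T -> \bar R).
Proof. by exists P. Qed.

End finite_mass.

Section discrete_kernel.
Context (R : realType) dX dA (X : measurableType dX) (A : measurableType dA).
Variables (w : nat -> X -> R) (e : nat -> A).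
Hypothesis w0 : forall n x, 0 <= w n x.
Hypothesis mw : forall n, measurable_fun setT (w n).
Hypothesis w1 : forall x, (\sum_(n <oo) (w n x)%:E = 1)%E.
Local Open Scope ereal_scope.

Definition discrete_kernel (x : X) : {measure set A -> \bar R} :=
  mseries (fun n => mscale (NngNum (w0 n x)) (\d_(e n))) 0.

Let dkE x S : discrete_kernel x S = \sum_(n <oo) (w n x)%:E * (\1_S (e n))%:E.
Proof. by []. Qed.

Let measurable_discrete_kernel S : measurable S ->
  measurable_fun setT (discrete_kernel ^~ S).
Proof.
move=> mS; under eq_fun do rewrite dkE.
apply: ge0_emeasurable_sum => [n x _ _|n _].
  by rewrite mule_ge0// lee_fin.
apply: emeasurable_funM; last exact: measurable_cst.
exact/measurable_EFinP.
Qed.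

HB.instance Definition _ := isKernel.Build _ _ _ _ R discrete_kernel
  measurable_discrete_kernel.

Let discrete_kernelT x : discrete_kernel x setT = 1.
Proof.
rewrite dkE -[RHS](w1 x); apply: eq_eseriesr => n _.
by rewrite indicT mule1.
Qed.

HB.instance Definition _ := Kernel_isProbability.Build _ _ _ _ R discrete_kernel
  discrete_kernelT.

Lemma discrete_kernel_exists : exists p : R.-pker X ~> A,
  forall x S, p x S = \sum_(n <oo) (w n x)%:E * (\1_S (e n))%:E.
Proof. by exists discrete_kernel. Qed.

End discrete_kernel.

Section disintegration.
Context (R : realType) dX dA (X : measurableType dX) (A : measurableType dA).
Variables (g : probability (X * A)%type R) (zeta : probability X R).
Variable Gr : set (X * A).
Hypothesis mA : forall S : set A, measurable S.
Hypothesis cntA : countable [set: A].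
Hypothesis mGr : measurable Gr.
Hypothesis Gr_nonempty : forall x, exists a, Gr (x, a).
Hypothesis g_Gr : (g (~` Gr) = 0)%E.
Hypothesis g_zeta : forall B, measurable B -> g (B `*` setT) = zeta B.
Local Open Scope ereal_scope.

(** The density [f n] of the slice of [g] at the action numbered [n] with respect
    to the marginal [zeta] is the conditional probability of that action. The
    densities of admissible actions sum to 1 only for almost every state; at
    the exceptional states the first admissible action in the enumeration is
    chosen, which keeps the kernel measurable and admissible everywhere. *)
Lemma discrete_disintegration : exists p : R.-pker X ~> A,
  [/\ forall x, p x [set a | Gr (x, a)] = 1,
    forall S, measurable S -> measurable_fun setT (fun x => p x [set a | S (x, a)]) &
    forall S, measurable S -> g S = \int[zeta]_x p x [set a | S (x, a)]].
Proof.
have /countable_injP[iota injiota] := cntA.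
have iotaI a b : iota a = iota b -> a = b by apply: injiota; rewrite in_setT.
pose fib n := [set a | iota a = n].
(* [e n] is the action numbered [n]. When there is none, the fibre [fib n] is
   empty and the default value is harmless, the density of its slice being
   almost everywhere zero. *)
have /choice[e eP] n : exists b, forall a, iota a = n -> b = a.
  have [[a an]|nex] := pselect (exists a, iota a = n).
    by exists a => b bn; apply: iotaI; rewrite an.
  by exists point => a an; case: nex; exists a.
pose sec (S : set (X * A)) n := [set x | S (x, e n)].
have msec S n : measurable S -> measurable (sec S n).
  by move=> mS; rewrite -[X in measurable X]setTI; exact: pair2_measurable.
have /choice[nu nuE] n : exists l : {finite_measure set X -> \bar R},
    forall B, measurable B -> l B = g (B `*` fib n).
  have mX : measurable ([set: X] `*` fib n) by exact: measurableX.
  have [l lE] := pushforward_measure (mrestr g mX) (@measurable_fst _ _ X A).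
  have lE' B : l B = g (B `*` fib n).
    rewrite lE -[LHS]/(g (fst @^-1` B `&` ([set: X] `*` fib n))).
    by congr (g _); apply/seteqP; split=> -[x a] /= [? //] [].
  have lT : l setT < +oo.
    by rewrite lE'; apply: le_lt_trans (probability_le1 g mX) (ltry _).
  have [l' l'E] := measure_to_finite lT.
  by exists l' => B _; rewrite l'E.
have nu_dom n : nu n `<< zeta.
  apply/null_content_dominatesP => B mB zB0; apply/eqP.
  have gB0 : g (B `*` setT) = 0 by rewrite g_zeta.
  rewrite eq_le measure_ge0 andbT nuE// -gB0.
  by apply: le_measure; rewrite ?inE; [exact: measurableX|exact: measurableX|
    by move=> z []].
pose f n := Radon_Nikodym_SigmaFinite.f (nu n) zeta.
have f0 n x : 0 <= f n x by exact: Radon_Nikodym_SigmaFinite.f_ge0.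
have ffin n x : f n x \is a fin_num by exact: Radon_Nikodym_SigmaFinite.f_fin_num.
have mf n : measurable_fun setT (f n).
  exact: measurable_int (Radon_Nikodym_SigmaFinite.f_integrable (nu_dom n)).
have fint n B : measurable B -> nu n B = \int[zeta]_(x in B) f n x.
  by move=> mB; exact: Radon_Nikodym_SigmaFinite.f_integral.
pose s S x := \sum_(n <oo) f n x * (\1_(sec S n) x)%:E.
have ms_term S n : measurable S ->
    measurable_fun setT (fun x => f n x * (\1_(sec S n) x)%:E).
  move=> mS; apply: emeasurable_funM => //.
  by apply/measurable_EFinP/measurable_indic; exact: msec.
have s_term0 S n x : 0 <= f n x * (\1_(sec S n) x)%:E.
  by rewrite mule_ge0// lee_fin.
have mms S : measurable S -> measurable_fun setT (s S).
  move=> mS; apply: ge0_emeasurable_sum => [n x _ _|n _]; first exact: s_term0.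
  exact: ms_term.
have s_int S B : measurable S -> measurable B ->
    \int[zeta]_(x in B) s S x = g (S `&` (B `*` setT)).
  move=> mS mB; rewrite /s integral_nneseries//; last first.
    by move=> n; apply: measurable_funTS; exact: ms_term.
  have -> : S `&` (B `*` setT) = \bigcup_n (S `&` (B `*` fib n)).
    apply/seteqP; split=> [[x a] [Sx [Bx _]]|[x a] [n _ [Sx [Bx _]]]] //.
    by exists (iota a).
  rewrite measure_semi_bigcup; last 3 first.
  - by move=> n; apply: measurableI => //; exact: measurableX.
  - apply/trivIsetP => i j _ _ ij; rewrite -subset0 => -[x a] [[_ [_ /= ai]] [_ [_ /= aj]]].
    by move/eqP : ij; rewrite -ai -aj.
  - by apply: bigcup_measurable => n _; apply: measurableI => //; exact: measurableX.
  apply: eq_eseriesr => n _.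
  rewrite (eq_integral (f n \_ (sec S n))); last by move=> x _; rewrite epatch_indic.
  rewrite -integral_mkcondr -fint; last by apply: measurableI => //; exact: msec.
  rewrite nuE; last by apply: measurableI => //; exact: msec.
  congr (g _); apply/seteqP; split=> [[x a] [[/= Bx Sx] an]|[x a] [Sx [Bx /= an]]].
    by split=> //; rewrite -(eP n a an).
  by split => //; split => //; rewrite /sec/= (eP n a an).
pose good := [set x | s Gr x = 1].
have mgood : measurable good.
  by rewrite -[good]setTI; apply: (mms _ mGr measurableT [set 1]); exact: emeasurable_set1.
have good_ae : zeta (~` good) = 0.
  have intc B : measurable B -> \int[zeta]_(x in B) cst 1 x = \int[zeta]_(x in B) s Gr x.
    move=> mB; rewrite s_int// integral_cst// mul1e -g_zeta//.
    apply/eqP; rewrite eq_le; apply/andP; split; last first.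
      apply: le_measure; rewrite ?inE; [|exact: measurableX|by move=> z []].
      by apply: measurableI => //; exact: measurableX.
    have mBX : measurable (B `*` [set: A]) by exact: measurableX.
    have mGC : measurable (~` Gr) by exact: measurableC.
    rewrite -[leRHS]adde0 -g_Gr -measureU//.
    - apply: le_measure; rewrite ?inE//.
        by apply: measurableU => //; exact: measurableI.
      by move=> z Bz; have [Gz|nGz] := pselect (Gr z); [left|right].
    - exact: measurableI.
    - by rewrite -subset0 => z [[Gz _] nGz]; exact: nGz.
  have [N [mN N0 subN]] : ae_eq zeta setT (cst 1) (s Gr).
    apply: integral_ae_eq => //.
    - exact: (finite_measure_integrable_cst zeta 1%R measurableT).
    - exact: mms.
    - by move=> B _ mB; exact: intc.
  apply/eqP; rewrite eq_le measure_ge0 andbT -N0.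
  apply: le_measure; rewrite ?inE//; first exact: measurableC.
  by apply: subset_trans subN => x /= ngx; apply: contra_not ngx => /(_ I) /esym.
(* On [seqDU (sec Gr) n] the first admissible term of the sequence [e] is [e n]. *)
have msD n : measurable (seqDU (sec Gr) n).
  by apply: measurableD; [exact: msec|apply: bigsetU_measurable => i _; exact: msec].
pose w n x : R := (\1_good x * (fine (f n x) * \1_(sec Gr n) x) +
  \1_(~` good) x * \1_(seqDU (sec Gr) n) x)%R.
have w0 n x : (0 <= w n x)%R.
  by rewrite addr_ge0 ?mulr_ge0 ?fine_ge0.
have mgoodC : measurable (~` good) by exact: measurableC.
have mw n : measurable_fun setT (w n).
  apply: measurable_funD; apply: measurable_funM => //; try exact: measurable_indic.
  apply: measurable_funM; last by apply: measurable_indic; exact: msec.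
  exact: measurableT_comp.
have w_good n x : good x -> (w n x)%:E = f n x * (\1_(sec Gr n) x)%:E.
  move=> gx; rewrite /w [X in (X * _ + _)%R]indicE mem_set// mul1r.
  rewrite [X in (_ + X * _)%R]indicE memNset; last by [].
  by rewrite mul0r addr0 EFinM fineK.
have w_bad n x : ~ good x -> w n x = \1_(seqDU (sec Gr) n) x.
  move=> ngx; rewrite /w [X in (X * _ + _)%R]indicE memNset// mul0r add0r.
  by rewrite [X in (X * _)%R]indicE mem_set// mul1r.
have w1 x : \sum_(n <oo) (w n x)%:E = 1.
  have [gx|ngx] := pselect (good x).
    by rewrite -[RHS]gx; apply: eq_eseriesr => n _; exact: w_good.
  transitivity (\d_x (\bigcup_n seqDU (sec Gr) n) : \bar R).
    rewrite [RHS]measure_semi_bigcup//; last exact: bigcup_measurable.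
    by apply: eq_eseriesr => n _; rewrite w_bad.
  rewrite -seqDU_bigcup_eq /dirac indicE mem_set//.
  by have [a Ga] := Gr_nonempty x; exists (iota a) => //; rewrite /sec/= (eP _ a).
have [p pE] := discrete_kernel_exists e w0 mw w1.
have mp S : measurable S -> measurable_fun setT (fun x => p x [set a | S (x, a)]).
  move=> mS; under eq_fun do rewrite pE.
  apply: ge0_emeasurable_sum => [n x _ _|n _].
    by rewrite mule_ge0// lee_fin.
  apply: emeasurable_funM; first exact/measurable_EFinP.
  by apply/measurable_EFinP/measurable_indic; exact: msec mS.
exists p; split=> [x||S mS]; [|exact: mp|].
- rewrite pE -[RHS](w1 x); apply: eq_eseriesr => n _.
  have [ex|nex] := pselect (Gr (x, e n)).
    by rewrite indicE mem_set// mule1.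
  rewrite (_ : w n x = 0%R) ?mul0e// /w [X in (_ * (_ * X) + _)%R]indicE memNset//.
  by rewrite [X in (_ + _ * X)%R]indicE memNset ?mulr0 ?addr0// => -[].
- have -> : g S = g (S `&` Gr).
    have mSG : measurable (S `&` Gr) by exact: measurableI.
    have mSD : measurable (S `\` Gr) by exact: measurableD.
    apply/eqP; rewrite eq_le; apply/andP; split; last first.
      by apply: le_measure; rewrite ?inE//; move=> z [].
    have SD0 : g (S `\` Gr) = 0.
      apply/eqP; rewrite eq_le measure_ge0 andbT -g_Gr.
      by apply: le_measure; rewrite ?inE//; exact: measurableC.
    rewrite -[leRHS]adde0 -SD0 -measureU//.
      apply: le_measure; rewrite ?inE//; first exact: measurableU.
      by rewrite setUIDK.
    by rewrite -subset0 => z [[_ Gz] [_]].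
  rewrite -[X in g X]setIT -setXTT -s_int//; last exact: measurableI.
  apply: ge0_ae_eq_integral => //.
  + by apply: mms; exact: measurableI.
  + exact: mp.
  + by move=> x _; apply: nneseries_ge0 => n _ _; exact: s_term0.
  + exists (~` good); split => //.
    move=> x /= nx gx; apply: nx => _; rewrite pE; apply: eq_eseriesr => n _.
    rewrite w_good// -muleA -EFinM; congr (_ * _%:E).
    rewrite !indicE -natrM mulnb; congr (_%:R); congr (nat_of_bool _).
    apply/idP/andP => [/set_mem[Sx Gx]|[/set_mem Gx /set_mem Sx]].
      by split; apply/mem_set.
    by apply/mem_set; split.
Qed.

End disintegration.

(** * From stationary occupation measures to policies *)

Section memoryless_kernel.
Context (R : realType) dX dA (X : borelType dX) (A : borelType dA).
Variable p : R.-pker X ~> A.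
Local Open Scope ereal_scope.
Local Notation history n := (n.-tuple (X * A) * X)%type.

Definition memoryless_kernel n (h : history n) : {measure set A -> \bar R} := p h.2.

Let measurable_memoryless_kernel n S : measurable S ->
  measurable_fun setT ((@memoryless_kernel n) ^~ S).
Proof.
move=> mS.
exact: (measurableT_comp (measurable_kernel p S mS) measurable_snd).
Qed.

HB.instance Definition _ n := isKernel.Build _ _ _ _ R (@memoryless_kernel n)
  (@measurable_memoryless_kernel n).

Let memoryless_kernelT n h : @memoryless_kernel n h setT = 1.
Proof. exact: prob_kernel. Qed.

HB.instance Definition _ n := Kernel_isProbability.Build _ _ _ _ R
  (@memoryless_kernel n) (@memoryless_kernelT n).

End memoryless_kernel.

Section stationary_policy.
Context (R : realType) dX dA (X : borelType dX) (A : borelType dA) (d : nat).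
Variables (M : mdp R X A d).
Hypothesis dscA : discrete_space A.
Hypothesis cntA : countable [set: A].
Variable g : probability (X * A)%type R.
Hypothesis gs : stationary_occupation M g.
Local Open Scope ereal_scope.

Local Notation Gr := (mdp_graph M).
Local Notation q := (mdp_trans M).
Local Notation c := (mdp_cost M).

(** Playing the disintegration of [g] at every step, from the marginal of [g]:
    by induction the state law stays equal to the marginal, so each pair has
    law [g] and the averages of the costs do not depend on the horizon. *)
Lemma occupation_policy : exists (pi : policy M) (zeta : probability X R),
  forall i, average_cost pi zeta i = \int[g]_z c i z.
Proof.
have [g0 ginv] := gs.
have [zeta zetaE] : exists zeta : probability X R, forall B, zeta B = g (fst @^-1` B).
  have [l lE] := pushforward_measure g (@measurable_fst _ _ X A).
  have lT : l setT = 1 by rewrite lE preimage_setT; exact: (probability_setT g).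
  by have [zeta zE] := measure_to_probability lT; exists zeta => B; rewrite zE.
have g_zeta B : measurable B -> g (B `*` setT) = zeta B.
  by move=> _; rewrite zetaE setXT.
have Gr_ne x : exists a, Gr (x, a).
  by have [a Aa] := mdp_adm_nonempty M x; exists a.
have [p [padm mp pg]] := discrete_disintegration (@measurable_discrete _ A dscA) cntA
  (mdp_graph_measurable M) Gr_ne g0 g_zeta.
pose mu n : R.-pker _ ~> A := @memoryless_kernel R dX dA X A p n.
have mu_adm n h : mu n h (mdp_adm M h.2) = 1 by exact: padm.
pose pi : policy M := Policy mu_adm; exists pi, zeta.
pose P := history_law mu q zeta.
have lawS n : (forall B, measurable B -> P n [set h | B h.2] = zeta B) ->
    forall S, measurable S -> state_action_law mu q zeta n S = g S.
  move=> IH S mS; rewrite pg//.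
  transitivity (\int[P n]_h p h.2 [set a | S (h.2, a)]).
    rewrite -[LHS]/(\int[P n]_h state_action_kernel mu h S).
    apply: eq_integral => h _.
    exact: (state_action_kernelE mu h mS).
  transitivity (\int[pushforward (P n) snd]_x p x [set a | S (x, a)]).
    by rewrite ge0_integral_pushforward//; exact: mp.
  apply: eq_measure_integral => B mB _; exact: IH.
have law n B : measurable B -> P n [set h | B h.2] = zeta B.
  elim: n B => [//|n IH] B mB.
  rewrite -[LHS]/(state_law mu q zeta n.+1 B) state_law_succ//.
  rewrite -g_zeta// ginv//; apply: eq_measure_integral => S mS _.
  exact: lawS.
have cost i n : expected_cost pi zeta i n = n%:R%:E * \int[g]_z c i z.
  rewrite expected_costE (eq_bigr (fun=> \int[g]_z c i z)) => [|k _]; last first.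
    by apply: eq_measure_integral => S mS _; apply: lawS => //; exact: law.
  by rewrite mule_natl sumr_const card_ord.
move=> i; rewrite /average_cost.
have cv : (fun n => (n%:R^-1)%:E * expected_cost pi zeta i n) @ \oo -->
    \int[g]_z c i z.
  apply: cvg_near_cst; exists 1%N => // n /= n0.
  by rewrite cost muleA -EFinM mulVf ?pnatr_eq0 -?lt0n// mul1e.
by rewrite is_cvg_limn_esupE; [exact: cvg_lim cv|apply/cvg_ex; eexists; exact: cv].
Qed.

End stationary_policy.

Section main.
Context (R : realType) dX dA (X : borelType dX) (A : borelType dA) (d : nat).
Variables (M : mdp R X A d) (Gam : nat -> set (X * A)).
Hypothesis borelX : borel_space R X.
Hypothesis dscA : discrete_space A.
Hypothesis cntA : countable [set: A].
Hypothesis SU : cond_SU M Gam.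
Hypothesis condM : cond_M M Gam.
Local Open Scope ereal_scope.

Lemma primal_eq_optimal : primal_value M = optimal_cost M.
Proof.
apply/eqP; rewrite eq_le; apply/andP; split.
  apply: le_ereal_inf_tmp => _ [p pf <-].
  have [v vf vJ] := policy_primal borelX dscA cntA SU condM pf.
  by apply: le_trans vJ; apply: ereal_inf_lbound; exists v.
apply: le_ereal_inf_tmp => _ [v /occupation_of_primal[g [gs gv gfin gk]] <-].
have [pi [zeta J]] := occupation_policy dscA cntA gs.
rewrite -gv -J; apply: ereal_inf_lbound; exists (pi, zeta) => //.
by split; [rewrite /= J|move=> i; rewrite /= J].
Qed.

End main.

Theorem theorem4p2 (R : realType) (dX dA : measure_display)
    (X : borelType dX) (A : borelType dA) (d : nat) (M : mdp R X A d)
    (Gam : nat -> set (X * A)) :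
  borel_space R X ->
  discrete_space A ->
  countable [set: A] ->
  cond_G M ->
  cond_SU M Gam ->
  cond_M M Gam ->
  (primal_consistent M /\ primal_solvable M /\ dual_consistent M) /\
  (primal_value M = dual_value M /\ dual_value M = optimal_cost M).
Proof.
move=> borelX dscA cntA [p pf] SU condM.
have cons : primal_consistent M.
  by have [v vf _] := policy_primal borelX dscA cntA SU condM pf; exists v.
have pd : primal_value M = dual_value M.
  apply/eqP; rewrite eq_le dual_le_primal andbT.
  exact: (primal_le_dual borelX dscA cntA SU condM cons).
split; split.
- exact: cons.
- split; first exact: (primal_consistent_solvable borelX dscA cntA SU condM cons).
  by eexists; exact: dual_zero_feasible.
- exact: pd.
- by rewrite -pd; exact: (primal_eq_optimal borelX dscA cntA SU condM).
Qed.
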